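(* There is a deterministic static algorithm which, given a fractional matching ${\bf x}$ in a bipartite graph $G=(V,E)$ and an error parameter $\varepsilon\in(0,1)$, outputs an integral matching $M\subseteq\mathrm{supp}({\bf x})$ with $|M|\ge(1-\varepsilon)\|{\bf x}\|$ in time $O(|\mathrm{supp}({\bf x})|\cdot\log(\varepsilon^{-1}{\bf x}_{\min}^{-1}))$.
   Context: For ${\bf x}\in\mathbb{R}^E_{\ge0}$ write $x(v)=\sum_{e\ni v}x_e$, $\|{\bf x}\|=\sum_e x_e$, $\mathrm{supp}({\bf x})=\{e:x_e>0\}$ and ${\bf x}_{\min}=\min_{e\in\mathrm{supp}({\bf x})}x_e$. ${\bf x}$ is a fractional matching if $x(v)\le1$ for all $v\in V$. The model is the word RAM with $\Theta(\log n)$-bit words, $n=|V|$. *)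

(* Defs.v *)
From Stdlib Require PeanoNat.
From mathcomp Require Import all_boot all_order all_algebra.
From mathcomp Require Import reals exp.

Set Implicit Arguments.
Unset Strict Implicit.
Unset Printing Implicit Defensive.

Import Order.TTheory GRing.Theory Num.Theory.

(** * Fractional matchings *)

(* Graphs have vertex set 'I_n and edge set E : {set {set 'I_n}}.  A vector
   in R^E is a function on {set 'I_n} of which only the values on E matter. *)

Section Matchings.
Local Open Scope ring_scope.
Variables (R : realType) (n : nat).
Implicit Types (E M : {set {set 'I_n}}) (x : {set 'I_n} -> R).

Definition simple_graph E : Prop := forall e, e \in E -> #|e| = 2%N.

Definition bipartite E : Prop :=
  exists A : {set 'I_n}, forall e, e \in E ->
    exists u v, [/\ u \in A, v \notin A & e = [set u; v]].

Definition vertex_load E x (v : 'I_n) : R := \sum_(e in E | v \in e) x e.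

Definition fractional_matching E x : Prop :=
  (forall e, e \in E -> 0 <= x e) /\ (forall v, vertex_load E x v <= 1).

Definition norm1 E x : R := \sum_(e in E) x e.

Definition supp E x : {set {set 'I_n}} := [set e in E | 0 < x e].

(* The entries of a fractional matching are at most 1, so the default value 1
   only shows when the support is empty. *)
Definition xmin E x : R := \big[Num.min/1]_(e in supp E x) x e.

Definition integral_matching E M : Prop := M \subset E /\ trivIset M.

(* es lists every edge of S exactly once, each with an arbitrary orientation. *)
Definition edge_list (S : {set {set 'I_n}}) (es : seq ('I_n * 'I_n)) : Prop :=
  uniq [seq [set p.1; p.2] | p <- es] /\
  [seq [set p.1; p.2] | p <- es] =i S.

End Matchings.

(** * The word RAM *)

(* Words are the naturals below 2 ^ w.  Registers and memory cells hold words,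
   memory is addressed by words, and the input is a read-only table of words
   with random access.  A program is a list of commands; every instruction and
   every evaluation of a test costs one step.  There is no source of
   randomness: step is a function. *)

Inductive binop :=
  | Add | Sub | Mul | Div | Mod | BAnd | BOr | BXor | Shl | Shr | Eq | Lt.

Inductive instr :=
  | Const of nat & nat              (* Const d c    : r_d := c *)
  | Op of binop & nat & nat & nat   (* Op o d a b   : r_d := r_a o r_b *)
  | Read of nat & nat               (* Read d a     : r_d := mem[r_a] *)
  | Write of nat & nat              (* Write a b    : mem[r_a] := r_b *)
  | Input of nat & nat & nat.       (* Input d a b  : r_d := input[r_a, r_b] *)

Inductive cmd :=
  | Do of instr
  | If of nat & seq cmd & seq cmd   (* tests r <> 0 *)
  | While of nat & seq cmd.

Definition prog := seq cmd.

Record state := State { reg : nat -> nat; mem : nat -> nat }.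

Definition upd (f : nat -> nat) (a v : nat) : nat -> nat :=
  fun b => if b == a then v else f b.

Section Machine.
Variables (w : nat) (input : nat -> nat -> nat).

Definition eval_binop (o : binop) (a b : nat) : nat :=
  match o with
  | Add => (a + b) %% 2 ^ w
  | Sub => (a + 2 ^ w - b) %% 2 ^ w
  | Mul => (a * b) %% 2 ^ w
  | Div => a %/ b
  | Mod => a %% b
  | BAnd => PeanoNat.Nat.land a b
  | BOr => PeanoNat.Nat.lor a b
  | BXor => PeanoNat.Nat.lxor a b
  | Shl => (a * 2 ^ b) %% 2 ^ w
  | Shr => a %/ 2 ^ b
  | Eq => a == b
  | Lt => a < b
  end.

Definition exec_instr (i : instr) (s : state) : state :=
  let: State r m := s in
  match i with
  | Const d c => State (upd r d (c %% 2 ^ w)) m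
  | Op o d a b => State (upd r d (eval_binop o (r a) (r b))) m
  | Read d a => State (upd r d (m (r a))) m
  | Write a b => State r (upd m (r a) (r b))
  | Input d a b => State (upd r d (input (r a) (r b))) m
  end.

(* A configuration consists of the commands still to be run and the state. *)
Definition step (c : prog * state) : prog * state :=
  let: (p, s) := c in
  match p with
  | [::] => c
  | Do i :: k => (k, exec_instr i s)
  | If a p1 p2 :: k => ((if reg s a != 0 then p1 else p2) ++ k, s)
  | While a q :: k => (if reg s a != 0 then q ++ While a q :: k else k, s)
  end.

Definition init_state : state := State (fun=> 0) (fun=> 0).

Definition halts_within (t : nat) (p : prog) (s : state) : Prop :=
  iter t step (p, init_state) = ([::], s).

End Machine.

(** * Input and output conventions *)

(* The k-th digit of y >= 0 in base 2 ^ w: digit 0 is the integer part of y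
   (modulo 2 ^ w), digit k > 0 the k-th digit after the radix point.  Fixed-point
   numbers are those whose digits eventually vanish. *)
Definition digit (R : realType) (w : nat) (y : R) (k : nat) : nat :=
  Num.truncn (y * 2%:R ^+ (w * k))%R %% 2 ^ w.

(* Row 0 holds n and |es|, row 1 the digits of eps, and row j + 2 the two
   endpoints of the j-th edge e of es followed by the digits of x e.  All other
   entries are 0.  With es an edge list of supp(x), neither the vertices nor
   the edges outside supp(x) are listed. *)
Definition encode (R : realType) (w n : nat) (x : {set 'I_n} -> R) (eps : R)
    (es : seq ('I_n * 'I_n)) (i k : nat) : nat :=
  match i with
  | 0 => nth 0 [:: n; size es] k
  | 1 => digit w eps k
  | j.+2 =>
    if onth es j is Some (u, v) then
      match k with
      | 0 => u
      | 1 => v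
      | l.+2 => digit w (x [set u; v]) l
      end
    else 0
  end.

(* Register 0 holds |M|, and memory starts with the endpoints of the edges of
   M, each edge listed once. *)
Definition outputs (n : nat) (s : state) (M : {set {set 'I_n}}) : Prop :=
  exists ms : seq ('I_n * 'I_n),
    [/\ edge_list M ms, reg s 0 = size ms &
        forall j u v, onth ms j = Some (u, v) ->
          mem s j.*2 = u /\ mem s j.*2.+1 = v].

(* Main.v *)
Require Import Defs.
From mathcomp Require Import all_boot all_order all_algebra.
From mathcomp Require Import reals exp.
From mathcomp Require boolp.
From mathcomp Require Import zify ring lra.
Import Order.TTheory GRing.Theory Num.Theory.
Local Open Scope ring_scope.

(* Write x_e in binary and round it down to L bits, where 2^-L <= eps xmin; this
   loses at most a factor 1 - eps of the norm.  Then remove the bits one by one,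
   from the least significant.  When the values are multiples of 2^-i, let F be
   the set of edges with an odd multiple; round the edges of F up or down to
   multiples of 2^-(i-1) so that at every vertex the numbers of edges rounded up
   and down differ by at most one, and no more edges are rounded down than up.
   Vertex loads stay at most 1 by parity, and the norm does not decrease.  To
   choose the directions, pair up the edges of F at every vertex: the pairs link
   F into paths and cycles, the cycles are even because the graph is bipartite,
   and one rounds alternately up and down along them, starting with up at an end
   of every path.  Each value is within one unit of its truncation, so that a
   carry bit per edge represents it.

   When eps xmin is close to 1, the time bound does not allow reading the whole
   input.  Therefore about (1 - eps) m of the m edges are inspected first: if all
   have x_e > 1/2, they form a matching, which is large enough; otherwise
   xmin <= 3/4 and the logarithm is bounded below. *)

Set Implicit Arguments.
Unset Strict Implicit.

Local Open Scope nat_scope.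

(** * Weakest preconditions with elapsed time *)

(** The time bound leaves no room for a term in [n], nor for a separate term in [m]. Hence no vertex
    array is swept: memory starts at 0, and the cells of the vertices are emptied through the
    endpoints of the edges. A level takes time O(m) because every walk is charged to the edges that
    it colours. The number of levels is the number of leading zeros of eps plus the largest such
    number among the x_e, at most 2 + 2 ln(1/(eps xmin)); its constant part is what requires a lower
    bound on the logarithm. Inspecting K edges beforehand is affordable since 1 - eps <= ln(1/eps),
    and K >= (1 - eps) m of them suffice since no weight exceeds 1.

    All paths are walked before any cycle. Afterwards every uncoloured half-edge is paired, so a
    walk from an arbitrary edge can only stop by closing up. That it closes with the right colours
    is not a count of its length: the colour about to be used is at all times a comparison of two
    sides of the bipartition. *)

Section WeakestPrecondition.
Variables (w : nat) (inp : nat -> nat -> nat).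
Implicit Types (p q : prog) (r mu : nat -> nat).

(** Total correctness with exact time. The quantified continuation [k] makes a run of [p]
    independent of what follows, so that runs concatenate; [Q] receives the number of steps. *)
Definition wp p (Q : nat -> (nat -> nat) -> (nat -> nat) -> Prop) r mu : Prop :=
  exists t r' mu',
    (forall k, iter t (step w inp) (p ++ k, State r mu) = (k, State r' mu')) /\
    Q t r' mu'.

Lemma wp_mono p (Q Q' : nat -> (nat -> nat) -> (nat -> nat) -> Prop) r mu :
  (forall t r' mu', Q t r' mu' -> Q' t r' mu') -> wp p Q r mu -> wp p Q' r mu.
Proof. by move=> QQ' [t [r' [mu' [H /QQ' HQ]]]]; exists t, r', mu'. Qed.

Lemma wp_nil (Q : nat -> (nat -> nat) -> (nat -> nat) -> Prop) r mu :
  Q 0 r mu -> wp [::] Q r mu.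
Proof. by move=> HQ; exists 0, r, mu. Qed.

Lemma wp_cat p q Q r mu :
  wp p (fun t => wp q (fun t' => Q (t + t'))) r mu -> wp (p ++ q) Q r mu.
Proof.
case=> t [r1 [mu1 [H1 [t' [r2 [mu2 [H2 HQ]]]]]]].
exists (t + t'), r2, mu2; split=> // k.
by rewrite addnC iterD -catA H1 H2.
Qed.

Lemma wp_step c p q Q r mu r1 mu1 :
  (forall k, step w inp (c :: k, State r mu) = (p ++ k, State r1 mu1)) ->
  wp (p ++ q) (fun t => Q t.+1) r1 mu1 -> wp (c :: q) Q r mu.
Proof.
move=> Hs [t [r' [mu' [H HQ]]]]; exists t.+1, r', mu'; split=> // k.
by rewrite iterSr cat_cons Hs catA H.
Qed.

Lemma wp_const d c q Q r mu : c < 2 ^ w ->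
  wp q (fun t => Q t.+1) (upd r d c) mu -> wp (Do (Const d c) :: q) Q r mu.
Proof. by move=> cw; apply: (@wp_step _ [::]) => k /=; rewrite modn_small. Qed.

Lemma wp_op v o d a b q Q r mu : eval_binop w o (r a) (r b) = v ->
  wp q (fun t => Q t.+1) (upd r d v) mu -> wp (Do (Op o d a b) :: q) Q r mu.
Proof. by move=> <-; apply: (@wp_step _ [::]). Qed.

Lemma wp_read v d a q Q r mu : mu (r a) = v ->
  wp q (fun t => Q t.+1) (upd r d v) mu -> wp (Do (Read d a) :: q) Q r mu.
Proof. by move=> <-; apply: (@wp_step _ [::]). Qed.

Lemma wp_write x v a b q Q r mu : r a = x -> r b = v ->
  wp q (fun t => Q t.+1) r (upd mu x v) -> wp (Do (Write a b) :: q) Q r mu.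
Proof. by move=> <- <-; apply: (@wp_step _ [::]). Qed.

Lemma wp_input v d a b q Q r mu : inp (r a) (r b) = v ->
  wp q (fun t => Q t.+1) (upd r d v) mu -> wp (Do (Input d a b) :: q) Q r mu.
Proof. by move=> <-; apply: (@wp_step _ [::]). Qed.

Lemma wp_if v a p1 p2 q Q r mu : r a = v ->
  wp ((if v != 0 then p1 else p2) ++ q) (fun t => Q t.+1) r mu ->
  wp (If a p1 p2 :: q) Q r mu.
Proof. by move=> <-; apply: wp_step. Qed.

(* A bound on the elapsed time also makes the loop terminate, since every
   iteration takes at least one step. *)
Lemma wp_while (I : nat -> (nat -> nat) -> (nat -> nat) -> Prop) B a p q Q r mu :
  I 0 r mu ->
  (forall t r' mu', I t r' mu' -> t <= B) ->
  (forall t r' mu', I t r' mu' -> r' a <> 0 ->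
     wp p (fun t' => I (t + t').+1) r' mu') ->
  (forall t r' mu', I t r' mu' -> r' a = 0 ->
     wp q (fun t' => Q (t + t').+1) r' mu') ->
  wp (While a p :: q) Q r mu.
Proof.
move=> I0 IB Ip Iq.
suff H : forall d t r' mu', B - t < d -> I t r' mu' ->
    wp (While a p :: q) (fun t' => Q (t + t')) r' mu'.
  by have := H (B - 0).+1 0 r mu (leqnn _) I0.
elim=> // d IH t r' mu' Bd It; have [ra|ra] := altP (r' a =P 0).
  apply: (@wp_step _ [::]) => [k|]; first by rewrite /= ra.
  by apply: wp_mono (Iq _ _ _ It ra) => t' r1 mu1; rewrite addnS.
apply: (@wp_step _ (p ++ [:: While a p])) => [k|].
  by rewrite /= ra -catA.
rewrite -catA; apply: wp_cat.
apply: wp_mono (Ip _ _ _ It (elimN eqP ra)) => t' r1 mu1 It'.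
have tB := IB _ _ _ It; have tB' := IB _ _ _ It'.
apply: wp_mono (IH _ _ _ _ It') => [t2 r2 mu2|]; last by lia.
by rewrite !addSn addnS addnA.
Qed.

End WeakestPrecondition.

(** * The program *)

(* Memory holds, for the edge j, its carry bit at 8j+2, a mark at 8j+3, and at
   8j+4+s the address of the half-edge paired with the half-edge (j, s), or 0;
   for the vertex v, 8v+7 holds the address of an unpaired half-edge at v.

   Registers 0-19 are global: 0 |M|; 1, 2, 3, 4, 6, 14, 15, 16 the constants
   1, 2, 3, 4, 8, 7, 0, 5; 5 the number of edges; 7 the number of edges
   inspected by the output loop; 8 the word 2^(w-1); 9, 10 a digit position and
   the mask of the current bit in that digit; 11 the current level; 12 the
   number of levels; 13 the failure flag of the shortcut; 18 the number of
   leading zeros of eps.  Registers from 20 on are local. *)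

Definition for_loop b (body : prog) : prog :=
  [:: Do (Const 20 0); Do (Op Lt 21 20 b);
      While 21 (body ++ [:: Do (Op Add 20 20 1); Do (Op Lt 21 20 b)])].

(** A mask shifted out to 0 is replaced by the top bit, held in register 8, and the next digit is
    entered. Adding register 15, which holds 0, serves as a move instruction. *)
Definition next_bit k mask : prog :=
  [:: Do (Op Div mask mask 2);
      If mask [::] [:: Do (Op Add mask 8 15); Do (Op Add k k 1)]].

(** Doubling the top bit overflows to 0, which signals the return to the lowest bit of the preceding
    digit. *)
Definition previous_bit : prog :=
  [:: Do (Op Add 10 10 10); If 10 [::] [:: Do (Const 10 1); Do (Op Defs.Sub 9 9 1)]].

Definition leading_bit : prog :=
  [:: Do (Const 24 0); Do (Const 25 0); Do (Const 26 1); Do (Const 27 1);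
      While 27
       [:: Do (Op Add 28 25 23); Do (Input 28 22 28); Do (Op Div 28 28 26);
           Do (Op Mod 28 28 2);
           If 28 [:: Do (Const 27 0)]
                 (next_bit 25 26 ++ [:: Do (Op Add 24 24 1)])]].

(** The cell of a vertex buffers one half-edge: a newcomer either waits there or is matched with the
    one that waits. Address 0 can stand for none because half-edges have addresses at least 4. *)
Definition pair_half s b : prog :=
  [:: Do (Input 28 22 s); Do (Op Mul 28 28 6); Do (Op Add 28 28 14);
      Do (Read 29 28); Do (Op Add 30 24 b); Do (Write 30 29);
      If 29 [:: Do (Write 29 30); Do (Write 28 15)] [:: Do (Write 28 30)]].

(** The current value of an edge is odd exactly when the bit read differs from the carry. Even edges
    are marked at once, so that no walk starts at them. *)
Definition pair_edge : prog :=
  [:: Do (Op Add 22 20 2); Do (Op Add 23 9 2); Do (Input 23 22 23);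
      Do (Op Div 23 23 10); Do (Op Mod 23 23 2); Do (Op Mul 24 20 6);
      Do (Op Add 25 24 2); Do (Read 25 25); Do (Op Eq 26 23 25);
      Do (Op Add 27 24 3); Do (Write 27 26);
      If 26 [::] (pair_half 15 4 ++ pair_half 1 16)].

Definition reset_half s : prog :=
  [:: Do (Input 28 22 s); Do (Op Mul 28 28 6); Do (Op Add 28 28 14);
      Do (Write 28 15)].

Definition reset_edge : prog :=
  Do (Op Add 22 20 2) :: reset_half 15 ++ reset_half 1.

Definition walk_step : prog :=
  [:: Do (Op Div 32 24 6); Do (Op Mul 32 32 6); Do (Op Add 33 32 3);
      Do (Write 33 1); Do (Op Add 33 32 2); Do (Write 33 30);
      Do (Op Eq 30 30 15); Do (Op Mod 33 24 2); Do (Op Eq 33 33 15);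
      Do (Op Add 34 32 4); Do (Op Add 34 34 33); Do (Read 24 34);
      If 24 [:: Do (Op Div 32 24 6); Do (Op Mul 32 32 6); Do (Op Add 33 32 3);
                Do (Read 33 33); Do (Op Eq 31 33 15)]
            [:: Do (Const 31 0)]].

Definition walk_from b f : prog :=
  [:: Do (Op Mul 22 20 6); Do (Op Add 23 22 3); Do (Read 23 23);
      Do (Op Add 24 22 b); Do (Read 25 24); Do (Op Eq 25 25 15);
      Do (Op Add 25 25 f); Do (Op Eq 26 23 15); Do (Op Mul 25 25 26);
      If 25 [:: Do (Const 30 1); Do (Const 31 1); While 31 walk_step] [::]].

(** The first two walking passes start only at unpaired half-edges, one pass for each end of the
    edges; the flag 0 comes from register 15. The third pass, with flag 1 from register 1, starts
    anywhere, when only cycles remain. *)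
Definition split_level : prog :=
  for_loop 5 pair_edge ++ for_loop 5 reset_edge ++
  for_loop 5 (walk_from 4 15) ++ for_loop 5 (walk_from 16 15) ++
  for_loop 5 (walk_from 4 1).

(** The carries are cleared here because an abandoned shortcut may have set some of them. *)
Definition precision_edge : prog :=
  [:: Do (Op Mul 22 20 6); Do (Op Add 22 22 2); Do (Write 22 15);
      Do (Op Add 22 20 2); Do (Const 23 2)] ++ leading_bit ++
  [:: Do (Op Lt 28 12 24); If 28 [:: Do (Op Add 12 24 15)] [::]].

Definition round_all : prog :=
  [:: Do (Const 22 1); Do (Const 23 0)] ++ leading_bit ++
  [:: Do (Op Add 18 24 15)] ++ for_loop 5 precision_edge ++
  [:: Do (Op Add 12 12 18); Do (Const 9 0); Do (Const 10 1)] ++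
  for_loop 12 (next_bit 9 10) ++
  [:: Do (Op Add 11 12 15);
      While 11 (split_level ++ previous_bit ++ [:: Do (Op Defs.Sub 11 11 1)]);
      Do (Op Add 7 5 15)].

(** One program serves all word sizes, so [2^w - 1] is obtained by letting 0 - 1 wrap around.
    Dividing by [(2^w - 1) / m] replaces a product with [m], which could overflow. *)
Definition setup : prog :=
  [:: Do (Const 1 1); Do (Const 2 2); Do (Const 3 3); Do (Const 4 4);
      Do (Const 6 8); Do (Const 14 7); Do (Const 16 5);
      Do (Op Defs.Sub 17 15 1); Do (Op Div 8 17 2); Do (Op Add 8 8 1);
      Do (Input 5 15 1); Do (Input 20 1 1);
      Do (Op Div 21 17 5); Do (Op Defs.Sub 20 17 20); Do (Op Div 20 20 21);
      Do (Op Add 7 20 1); Do (Op Lt 20 5 7);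
      If 20 [:: Do (Op Add 7 5 15)] [::]].

(** A successful test stores carry 1, so that [output_edge] selects the edge just as it would after
    the rounding. *)
Definition shortcut : prog :=
  [:: Do (Const 20 0); Do (Op Lt 21 20 7);
      While 21
       [:: Do (Op Add 22 20 2); Do (Input 23 22 2); Do (Input 24 22 3);
           Do (Op Lt 24 8 24); Do (Op Add 23 23 24);
           If 23 [:: Do (Op Mul 24 20 6); Do (Op Add 24 24 2); Do (Write 24 1);
                     Do (Op Add 20 20 1); Do (Op Lt 21 20 7)]
                 [:: Do (Const 13 1); Do (Const 21 0)]]].

Definition output_edge : prog :=
  [:: Do (Op Add 22 20 2); Do (Input 23 22 2); Do (Op Mul 24 20 6);
      Do (Op Add 24 24 2); Do (Read 24 24); Do (Op Add 23 23 24);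
      If 23 [:: Do (Input 25 22 15); Do (Input 26 22 1); Do (Op Mul 27 0 2);
                Do (Write 27 25); Do (Op Add 27 27 1); Do (Write 27 26);
                Do (Op Add 0 0 1)] [::]].

Definition rounding : prog :=
  setup ++ shortcut ++ [:: If 13 round_all [::]] ++ for_loop 7 output_edge.

(** These tactics discharge the side conditions of the [wp] rules: the contents of registers, the
    absence of overflow, and registers left untouched. *)
Ltac lookup := rewrite /upd /=;
  repeat match goal with H : ?r ?a = _ |- context [?r ?a] => rewrite H end.

Ltac word := lookup; rewrite /eval_binop ?modn_small; lia.

Ltac frame := rewrite /upd; repeat (case: eqP => ?; try lia); auto.

Section ForLoop.
Variables (w : nat) (inp : nat -> nat -> nat).

(** [I] is indexed by the counter and by the time spent in the bodies alone. The loop itself costs 3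
    steps per round, and 3 more for its start and its last test. [I] must tolerate changes of
    registers 20 and 21, which the loop owns. *)
Lemma wp_for (I : nat -> nat -> (nat -> nat) -> (nat -> nat) -> Prop)
    b N B body q Q r mu :
  b < 20 -> N < 2 ^ w -> 1 < 2 ^ w ->
  (forall j t r' mu', I j t r' mu' -> [/\ r' 1 = 1, r' b = N & t <= B]) ->
  (forall j t r' mu' u v, I j t r' mu' -> I j t (upd (upd r' 20 u) 21 v) mu') ->
  I 0 0 r mu ->
  (forall j t r' mu', j < N -> r' 20 = j -> I j t r' mu' ->
     wp w inp body (fun t' r2 mu2 => r2 20 = j /\ I j.+1 (t + t') r2 mu2) r' mu') ->
  (forall t r' mu', I N t r' mu' ->
     wp w inp q (fun t' => Q (t + 3 * N + 3 + t')) r' mu') ->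
  wp w inp (for_loop b body ++ q) Q r mu.
Proof.
move=> b20 NW W1 IB Iupd I0 Ibody Iq.
have [r1 rb _] := IB _ _ _ _ I0.
apply: wp_const; first lia.
apply: (@wp_op _ _ (0 < N)).
  have -> : upd r 20 0 b = N by frame.
  by lookup.
pose J t r' mu' := exists j t0,
  [/\ j <= N, t = t0 + 3 * j, I j t0 r' mu', r' 20 = j & r' 21 = (j < N)].
apply: (wp_while (I := J) (B := B + 3 * N)).
- by exists 0, 0; split => //; exact: Iupd.
- move=> t r' mu' [j [t0 [jN -> /IB [_ _ tB] _ _]]]; lia.
- move=> t r' mu' [j [t0 [jN -> It r20 r21]]] c1.
  have ltjN : j < N by move: c1; rewrite r21; case: ltnP.
  apply: wp_cat; apply: wp_mono (Ibody _ _ _ _ ltjN r20 It) => t' r2 mu2 [r220 I2].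
  have [r21' r2b _] := IB _ _ _ _ I2.
  apply: (@wp_op _ _ j.+1); first by word.
  apply: (@wp_op _ _ (j.+1 < N)).
    have -> : upd r2 20 j.+1 b = N by frame.
    by lookup.
  apply: wp_nil; exists j.+1, (t0 + t'); split => //; first lia.
  exact: Iupd.
- move=> t r' mu' [j [t0 [jN -> It r20 r21]]] c1.
  have jN' : j = N by move: c1; rewrite r21; case: ltnP => //; lia.
  rewrite jN' in It *; apply: wp_mono (Iq _ _ _ It) => t' r2 mu2.
  by congr Q; lia.
Qed.

End ForLoop.

(** * Pairing half-edges *)

Implicit Types (vx : nat -> nat) (H F : pred nat) (mu r : nat -> nat).

Definition agree c r r' := forall a, a < c -> r' a = r a.

Definition half_edge F m h :=
  [&& h %/ 8 < m, F (h %/ 8) & (h %% 8 == 4) || (h %% 8 == 5)].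

Definition half_address h := (h %% 8 == 4) || (h %% 8 == 5).

(** Since a cell has one content, [pairing_free] makes the unpaired half-edge at a vertex unique.
    This uniqueness is what remains once the cells are emptied. *)
Record pairing vx H mu : Prop := {
  pairing_mate : forall h, H h -> mu h <> 0 ->
    [/\ H (mu h), mu (mu h) = h, mu h <> h & vx (mu h) = vx h];
  pairing_dangling : forall v, mu (8 * v + 7) <> 0 ->
    [/\ H (mu (8 * v + 7)), vx (mu (8 * v + 7)) = v & mu (mu (8 * v + 7)) = 0];
  pairing_free : forall h, H h -> mu h = 0 -> mu (8 * vx h + 7) = h }.

Lemma updE f a v b : upd f a v b = if b == a then v else f b.
Proof. by []. Qed.

Lemma upd_same f a v : upd f a v a = v.
Proof. by rewrite updE eqxx. Qed.

Lemma upd_neq f a v b : b <> a -> upd f a v b = f b.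
Proof. by rewrite updE; case: eqP. Qed.

Definition pair_mem vx h mu :=
  let p := mu (8 * vx h + 7) in
  if p != 0 then upd (upd (upd mu h p) p h) (8 * vx h + 7) 0
  else upd (upd mu h p) (8 * vx h + 7) h.

Ltac side := first [lia | by auto | by apply: nesym; auto].

(** Cells of vertices have residue 7 modulo 8 and half-edges 4 or 5, so the writes never collide;
    the cell of [h] is fresh because [h] is not in [H]. *)
Lemma pairing_step vx H mu h :
  (forall g, H g -> half_address g) -> half_address h -> ~~ H h ->
  pairing vx H mu -> pairing vx (predU1 h H) (pair_mem vx h mu).
Proof.
move=> Hhalf hh Hh [mate dang free]; rewrite /pair_mem.
have n7 g v : half_address g -> g <> 8 * v + 7 by rewrite /half_address; lia.
have h0 g : half_address g -> g <> 0 by rewrite /half_address; lia.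
have nH g : H g -> g <> h by move=> Hg E; move: Hh; rewrite -E Hg.
have PH g : predU1 h H g = (g == h) || H g by [].
have side g v : half_address g -> 8 * v + 7 <> g by move=> /n7 /nesym.
set p := mu (8 * vx h + 7).
have [p0|p0] := altP (p =P 0) => /=.
- have nd v : v <> vx h -> upd (upd mu h p) (8 * vx h + 7) h (8 * v + 7) = mu (8 * v + 7).
    by move=> vv; rewrite !upd_neq //; side.
  have ng g : H g -> upd (upd mu h p) (8 * vx h + 7) h g = mu g.
    by move=> Hg; rewrite !upd_neq //; side.
  have nh : upd (upd mu h p) (8 * vx h + 7) h h = 0.
    by rewrite upd_neq ?upd_same //; exact: n7.
  split.
  + move=> g; rewrite PH => /orP [/eqP -> | Hg]; first by rewrite nh.
    rewrite ng // => g0; have [a b c d] := mate _ Hg g0.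
    by rewrite ng // PH a orbT.
  + move=> v; have [-> | /eqP vv] := eqVneq v (vx h).
      by rewrite upd_same => _; rewrite PH eqxx nh.
    rewrite nd // => v0; have [a b c] := dang _ v0.
    by rewrite ng // PH a orbT.
  + move=> g; rewrite PH => /orP [/eqP -> | Hg]; first by rewrite upd_same.
    rewrite ng // => g0; rewrite nd; first exact: free.
    (* An unpaired half-edge at the vertex of [h] would occupy the cell, which is empty here. *)
    by move=> E; have := free _ Hg g0; rewrite E -/p p0 => /esym; apply/h0/Hhalf.
- move/eqP: p0 => p0; have [Hp vp mp] := dang _ p0; rewrite -/p in Hp vp mp.
  set nu := upd _ _ 0.
  have nd v : v <> vx h -> nu (8 * v + 7) = mu (8 * v + 7).
    by move=> vv; rewrite /nu !upd_neq //; side.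
  have ng g : H g -> g <> p -> nu g = mu g.
    by move=> Hg gp; rewrite /nu !upd_neq //; side.
  have nh : nu h = p.
    rewrite /nu upd_neq; last exact: n7.
    by rewrite upd_neq ?upd_same //; apply/nesym/nH.
  have np : nu p = h.
    by rewrite /nu upd_neq ?upd_same //; apply: n7; apply: Hhalf.
  have ns : nu (8 * vx h + 7) = 0 by rewrite /nu upd_same.
  split.
  + move=> g; rewrite PH => /orP [/eqP -> | Hg].
      by rewrite nh np PH Hp orbT => _; split=> //; exact: nH.
    have [-> | /eqP gp] := eqVneq g p.
      by rewrite np nh PH eqxx => _; split=> //; apply/nesym/nH.
    rewrite ng // => g0; have [a b c d] := mate _ Hg g0.
    rewrite ng //; first by rewrite PH a orbT.
    by move=> E; move: b; rewrite E mp => /esym; apply/h0/Hhalf.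
  + move=> v; have [-> | /eqP vv] := eqVneq v (vx h); first by rewrite ns.
    rewrite nd // => v0; have [a b c] := dang _ v0.
    rewrite ng //; first by rewrite PH a orbT.
    by move=> E; apply: vv; rewrite -b E.
  + move=> g; rewrite PH => /orP [/eqP -> | Hg]; first by rewrite nh.
    have [-> | /eqP gp] := eqVneq g p; first by rewrite np => /h0; case.
    rewrite ng // => g0; rewrite nd; first exact: free.
    by move=> E; apply: gp; rewrite -(free _ Hg g0) E.
Qed.

Lemma eq_pairing vx H H' mu : H =1 H' -> pairing vx H mu -> pairing vx H' mu.
Proof.
move=> E [a b c]; split.
- by move=> h; rewrite -!E => Hh /(a _ Hh) [].
- by move=> v /b []; rewrite E.
- by move=> h; rewrite -E; exact: c.
Qed.

Lemma half_edge_addr F m h : half_edge F m h -> half_address h.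
Proof. by rewrite /half_edge; case/and3P. Qed.

Lemma half_edgeS F m h : half_edge F m.+1 h =
  if F m then [|| h == 8 * m + 5, h == 8 * m + 4 | half_edge F m h]
  else half_edge F m h.
Proof.
rewrite /half_edge ltnS; have [E | hm] := eqVneq (h %/ 8) m.
  by rewrite E leqnn ltnn; case: (F m) => /=; lia.
by rewrite leq_eqVlt (negPf hm) /=; case: (F m) => //=; lia.
Qed.

Definition vertex_at (Z : nat -> nat -> nat) h := Z (h %/ 8) (h %% 4).

Lemma vertex_atE Z j s : s < 2 -> vertex_at Z (8 * j + 4 + s) = Z j s.
Proof. by move=> s2; rewrite /vertex_at; congr Z; lia. Qed.

(** Pairing writes only at residues 4, 5 and 7 modulo 8, so carries and marks survive. *)
Lemma pair_mem_carry vx H mu h j f : (forall g, H g -> half_address g) ->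
  half_address h -> pairing vx H mu -> f < 4 ->
  pair_mem vx h mu (8 * j + f) = mu (8 * j + f).
Proof.
rewrite /pair_mem /half_address => Hh hh [_ D _] f4.
have Q := D (vx h); move: Q; set p := mu (8 * vx h + 7) => Q.
case: (altP (p =P 0)) => [_|/eqP /Q [/Hh Hp _ _]] /=;
  by rewrite !upd_neq //; lia.
Qed.

Definition consts m r : Prop :=
  [/\ r 1 = 1, r 2 = 2, r 3 = 3 & r 4 = 4] /\
  [/\ r 6 = 8, r 14 = 7, r 15 = 0, r 16 = 5 & r 5 = m].

Lemma agree_consts m r r' c : 20 <= c -> agree c r r' -> consts m r -> consts m r'.
Proof.
move=> c20 A; rewrite /consts !A //; apply: leq_trans c20 => //.
Qed.

Lemma agree_trans c c' r1 r2 r3 : c <= c' -> agree c r1 r2 -> agree c' r2 r3 -> agree c r1 r3.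
Proof. by move=> cc A A' a ac; rewrite A' ?A //; apply: leq_trans cc. Qed.

Record graph_input w inp m Z : Prop := {
  word_large : 256 <= 2 ^ w;
  edges_small : 8 * m + 8 <= 2 ^ w;
  vertices_small : forall j s, j < m -> s < 2 -> 8 * Z j s + 8 <= 2 ^ w;
  input_vertex : forall j s, j < m -> s < 2 -> inp (j + 2) s = Z j s }.

Section Split.
Variables (w : nat) (inp : nat -> nat -> nat) (m : nat) (Z : nat -> nat -> nat).
Hypothesis G : graph_input w inp m Z.

Notation wp := (wp w inp).
Notation vx := (vertex_at Z).

Lemma wp_pair_half j s ks kb H r mu : j < m -> s < 2 -> ks < 20 -> kb < 20 ->
  consts m r -> r ks = s -> r kb = 4 + s -> r 22 = j + 2 -> r 24 = 8 * j ->
  (forall g, H g -> half_address g) -> ~~ H (8 * j + 4 + s) ->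
  pairing vx H mu ->
  wp (pair_half ks kb) (fun t r' mu' => [/\ t <= 9, agree 28 r r',
    pairing vx (predU1 (8 * j + 4 + s) H) mu' &
    forall i f, f < 4 -> mu' (8 * i + f) = mu (8 * i + f)]) r mu.
Proof.
move=> jm s2 ks20 kb20 [[r1 r2 r3 r4] [r6 r14 r15 r16 r5]] rs rb r22 r24 HH Hn P.
have [W M _ _] := G; have Zs := vertices_small G jm s2.
have hh : half_address (8 * j + 4 + s) by rewrite /half_address; lia.
have vxh := vertex_atE Z j s2.
have P' := pairing_step HH hh Hn P.
have C' i f := pair_mem_carry i HH hh P (f := f).
move: P' C'; rewrite /pair_mem vxh => P' C'.
apply: (@wp_input _ _ (Z j s)); first by lookup; exact: input_vertex G _ _ jm s2.
apply: (@wp_op _ _ (8 * Z j s)); first by word.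
apply: (@wp_op _ _ (8 * Z j s + 7)); first by word.
set p := mu (8 * Z j s + 7) in P' C'.
apply: (@wp_read _ _ p); first by lookup.
apply: (@wp_op _ _ (8 * j + 4 + s)).
  have -> : forall x1 x2 x3 x4, upd (upd (upd (upd r 28 x1) 28 x2) 28 x3) 29 x4 kb = r kb.
    by move=> *; frame.
  by word.
apply: (@wp_write _ _ (8 * j + 4 + s) p); [by lookup | by lookup|].
apply: (@wp_if _ _ p); first by lookup.
move: P' C'; case: (p != 0) => /= P' C'.
- apply: (@wp_write _ _ p (8 * j + 4 + s)); [by lookup| by lookup|].
  apply: (@wp_write _ _ (8 * Z j s + 7) 0); [by lookup| by lookup|].
  by apply: wp_nil; split=> // a a28; frame.
- apply: (@wp_write _ _ (8 * Z j s + 7) (8 * j + 4 + s)); [by lookup| by lookup|].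
  by apply: wp_nil; split=> // a a28; frame.
Qed.

End Split.

(** * Emptying the cells of the vertices *)

Definition no_dangling mu := forall v, mu (8 * v + 7) = 0.

Section Reset.
Variables (w : nat) (inp : nat -> nat -> nat) (m : nat) (Z : nat -> nat -> nat).
Hypothesis G : graph_input w inp m Z.

Notation wp := (wp w inp).

Lemma wp_reset_half j s ks r mu : j < m -> s < 2 -> ks < 20 ->
  consts m r -> r ks = s -> r 22 = j + 2 ->
  wp (reset_half ks) (fun t r' mu' => [/\ t = 4, agree 28 r r' &
     mu' = upd mu (8 * Z j s + 7) 0]) r mu.
Proof.
move=> jm s2 ks20 [[r1 r2 r3 r4] [r6 r14 r15 r16 r5]] rs r22.
have [W M _ _] := G; have Zs := vertices_small G jm s2.
apply: (@wp_input _ _ (Z j s)); first by lookup; exact: input_vertex G _ _ jm s2.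
apply: (@wp_op _ _ (8 * Z j s)); first by word.
apply: (@wp_op _ _ (8 * Z j s + 7)); first by word.
apply: (@wp_write _ _ (8 * Z j s + 7) 0); [by lookup | by lookup|].
by apply: wp_nil; split=> // a a28; frame.
Qed.

(** By the invariant, a cell still filled after [j] rounds belongs to an endpoint of an edge with
    index at least [j]. *)
Lemma wp_reset_loop q Q r mu : consts m r ->
  (forall v, mu (8 * v + 7) <> 0 -> exists j s, [/\ j < m, s < 2 & v = Z j s]) ->
  (forall t r' mu', t <= 12 * m + 3 -> agree 20 r r' -> no_dangling mu' ->
    (forall h, h %% 8 <> 7 -> mu' h = mu h) ->
    wp q (fun t' => Q (t + t')) r' mu') ->
  wp (for_loop 5 reset_edge ++ q) Q r mu.
Proof.
move=> C Hd HQ; have [W M _ _] := G.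
pose I j t r' mu' := [/\ j <= m, t <= 9 * j & agree 20 r r'] /\
  [/\ forall v, mu' (8 * v + 7) <> 0 ->
        exists i s, [/\ j <= i, i < m, s < 2 & v = Z i s] &
      forall h, h %% 8 <> 7 -> mu' h = mu h].
apply: (wp_for (I := I) (N := m) (B := 9 * m)) => //; try lia.
- move=> j t r' mu' [[jm tj A] _]; have [[? _ _ _] [_ _ _ _ ?]] := agree_consts (leqnn 20) A C.
  by split=> //; lia.
- move=> j t r' mu' u v [[jm tj A] H]; split=> //; split=> // a a20.
  by rewrite -A //; frame.
- split; first by split.
  by split=> // v /Hd [j [s [? ? ?]]]; exists j, s.
- move=> j t r' mu' jm r20 [[_ tj A] [K1 K2]].
  have C1 := agree_consts (leqnn 20) A C; have [[r1 r2 r3 r4] [r6 r14 r15 r16 r5]] := C1.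
  apply: (@wp_op _ _ (j + 2)); first by word.
  set r1' := upd _ 22 _.
  have A1 : agree 21 r' r1' by move=> a a21; rewrite /r1'; frame.
  have A22 : r1' 22 = j + 2 by rewrite /r1'; lookup.
  have A20 : agree 20 r' r1' by move=> a a20; apply: A1; lia.
  have C2 := agree_consts (leqnn 20) A20 C1; clearbody r1'.
  have [[_ _ _ _] [_ _ r115 _ _]] := C2.
  apply: wp_cat; apply: wp_mono (wp_reset_half (s := 0) mu' jm _ _ C2 r115 A22) => //.
  move=> t1 r2' mu2 [-> A2 ->].
  have A220 : agree 20 r1' r2' by move=> a a20; apply: A2; lia.
  have C3 := agree_consts (leqnn 20) A220 C2; have [[r21 _ _ _] _] := C3.
  apply: wp_mono (wp_reset_half (s := 1) _ jm _ _ C3 r21 _) => //; last by rewrite A2.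
  move=> t2 r3' mu3 [-> A3 ->]; split; first by rewrite A3 ?A2 ?A1.
  split.
    split=> //; first lia.
    by move=> a a20; rewrite A3 ?A2 ?A1 ?A //; lia.
  split.
    move=> v; rewrite !updE; case: eqP => // n1; case: eqP => // n0.
    move=> /K1 [i [s [ji im s2 E]]]; exists i, s; split=> //.
    rewrite ltn_neqAle ji andbT; apply/eqP => ij; subst i.
    by move: s2 E => /=; case: s => [|[|//]] _ E; [apply: n0|apply: n1]; rewrite E.
  by move=> h h7; rewrite !upd_neq ?K2 //; lia.
- move=> t r' mu' [[_ tm A] [K1 K2]].
  apply: wp_mono (HQ (t + 3 * m + 3) r' mu' _ A _ K2) => //; first lia.
  move=> v; apply/eqP; case: eqP => // /K1 [i [s []]]; lia.
Qed.

End Reset.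

(** * Selecting and pairing the odd edges of a level *)

Section PairingLoop.
Variables (w : nat) (inp : nat -> nat -> nat) (m : nat) (Z : nat -> nat -> nat).
Hypothesis G : graph_input w inp m Z.
Variables (D : nat -> nat) (k mask : nat).
Hypothesis k_small : k + 2 < 2 ^ w.
Hypothesis D_bit : forall j, j < m -> (inp (j + 2) (k + 2) %/ mask) %% 2 = D j.

Notation wp := (wp w inp).
Notation vx := (vertex_at Z).

Lemma wp_pair_edge j F mu0 r mu : j < m -> consts m r -> r 9 = k ->
  r 10 = mask -> r 20 = j -> (forall i, F i = (D i != mu0 (8 * i + 2))) ->
  (forall i, i < j -> mu (8 * i + 3) = ~~ F i) ->
  (forall i, mu (8 * i + 2) = mu0 (8 * i + 2)) ->
  pairing vx (half_edge F j) mu ->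
  wp pair_edge (fun t r' mu' => [/\ t <= 40, agree 21 r r',
    pairing vx (half_edge F j.+1) mu',
    forall i, i < j.+1 -> mu' (8 * i + 3) = ~~ F i &
    forall i, mu' (8 * i + 2) = mu0 (8 * i + 2)]) r mu.
Proof.
move=> jm C r9 r10 r20 FE markmu carrymu P.
have [[r1 r2 r3 r4] [r6 r14 r15 r16 r5]] := C.
have [W M _ _] := G.
have D2 := D_bit jm.
have H22 : inp (j + 2) (k + 2) %/ mask %% 2 < 2 by rewrite ltn_mod.
apply: (@wp_op _ _ (j + 2)); first by word.
apply: (@wp_op _ _ (k + 2)); first by word.
apply: (@wp_input _ _ (inp (j + 2) (k + 2))); first by lookup.
apply: (@wp_op _ _ (inp (j + 2) (k + 2) %/ mask)); first by lookup.
apply: (@wp_op _ _ (D j)); first by lookup; rewrite -D2.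
apply: (@wp_op _ _ (8 * j)); first by word.
apply: (@wp_op _ _ (8 * j + 2)); first by word.
apply: (@wp_read _ _ (mu0 (8 * j + 2))); first by lookup; exact: carrymu.
apply: (@wp_op _ _ (~~ F j : nat)).
  by lookup; rewrite /eval_binop FE negbK.
apply: (@wp_op _ _ (8 * j + 3)); first by word.
apply: (@wp_write _ _ (8 * j + 3) (~~ F j)); [by lookup| by lookup|].
apply: (@wp_if _ _ (~~ F j)); first by lookup.
have P1 : pairing vx (half_edge F j) (upd mu (8 * j + 3) (~~ F j)).
  case: P => a b c; have nH h : half_edge F j h -> h <> 8 * j + 3.
    by move=> /half_edge_addr; rewrite /half_address; lia.
  have n7 v : 8 * v + 7 <> 8 * j + 3 by lia.
  split.
  - move=> h Hh; rewrite upd_neq; last exact: nH.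
    by move=> h0; have [a1 a2 a3 a4] := a _ Hh h0; rewrite upd_neq; [|exact: nH].
  - move=> v; rewrite upd_neq // => v0.
    by have [a1 a2 a3] := b _ v0; rewrite upd_neq; [|exact: nH].
  - by move=> h Hh; rewrite !upd_neq //; [exact: c|exact: nH].
have mark1 i : i < j.+1 -> upd mu (8 * j + 3) (~~ F j) (8 * i + 3) = ~~ F i.
  rewrite ltnS leq_eqVlt => /orP [/eqP -> |ij]; first by rewrite upd_same.
  by rewrite upd_neq; [exact: markmu | lia].
have carry1 i : upd mu (8 * j + 3) (~~ F j) (8 * i + 2) = mu0 (8 * i + 2).
  by rewrite upd_neq; [exact: carrymu | lia].
case Fj: (F j) => /=; last first.
  apply: wp_nil; split=> //; first by move=> a a21; frame.
  - by rewrite Fj in P1; apply: eq_pairing P1 => h; rewrite half_edgeS Fj.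
  - by move: mark1; rewrite Fj.
  - by move: carry1; rewrite Fj.
set r1' := upd _ 27 _; set mu1 := upd mu _ _.
have A0 : agree 20 r r1' by move=> a a20; rewrite /r1'; frame.
have Aj : r1' 20 = j by rewrite /r1'; lookup.
have A22 : r1' 22 = j + 2 by rewrite /r1'; lookup.
have A24 : r1' 24 = 8 * j by rewrite /r1'; lookup.
have A21 : agree 21 r r1' by move=> a a21; rewrite /r1'; frame.
have C1 := agree_consts (leqnn 20) A0 C.
clearbody r1'; apply: (@wp_cat _ _ (pair_half 15 4) (pair_half 1 16)).
have P1' : pairing vx (half_edge F j) mu1 by move: P1; rewrite Fj.
have nH s : s < 2 -> ~~ half_edge F j (8 * j + 4 + s).
  by move=> s2; rewrite /half_edge; lia.
have [[_ _ _ r14'] [_ _ r115 r116 _]] := C1.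
apply: wp_mono (wp_pair_half G jm (isT : 0 < 2) _ _ C1 _ _ A22 A24 _ (nH 0 isT) P1') => //;
  last exact: half_edge_addr.
move=> t r2' mu2 [t9 A2 P2 M2].
have A2' : agree 20 r1' r2' by move=> a a20; apply: A2; lia.
have C2 := agree_consts (leqnn 20) A2' C1.
have [[r11' r12' _ r24'] [_ _ r215 r216 _]] := C2.
have H2 h : predU1 (8 * j + 4 + 0) (half_edge F j) h = (h == 8 * j + 4) || half_edge F j h.
  by rewrite addn0.
apply: wp_mono (wp_pair_half (s := 1) G jm _ _ _ C2 _ _ _ _ _ _ P2) => //; rewrite ?A2 //.
- move=> t' r3' mu3 [t9' A3 P3 M3]; split.
  + lia.
  + by move=> a a21; rewrite A3 ?A2 ?A21 //; lia.
  + apply: eq_pairing P3 => h; change ((h == 8 * j + 4 + 1) ||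
      predU1 (8 * j + 4 + 0) (half_edge F j) h = half_edge F j.+1 h).
    by rewrite H2 half_edgeS Fj -addnA.
  + by move=> i ij; rewrite M3 // M2 //; rewrite Fj in mark1; exact: mark1.
  + by move=> i; rewrite M3 // M2 //; rewrite Fj in carry1; exact: carry1.
- by move=> g; rewrite H2 => /orP [/eqP -> |/half_edge_addr //]; rewrite /half_address; lia.
- by rewrite H2; rewrite negb_or nH // andbT; lia.
Qed.

Lemma wp_pair_loop F q Q r mu : consts m r -> r 9 = k -> r 10 = mask ->
  (forall i, F i = (D i != mu (8 * i + 2))) -> no_dangling mu ->
  (forall t r' mu', t <= 43 * m + 3 -> agree 20 r r' ->
    pairing vx (half_edge F m) mu' ->
    (forall i, i < m -> mu' (8 * i + 3) = ~~ F i) ->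
    (forall i, mu' (8 * i + 2) = mu (8 * i + 2)) ->
    wp q (fun t' => Q (t + t')) r' mu') ->
  wp (for_loop 5 pair_edge ++ q) Q r mu.
Proof.
move=> C r9 r10 FE nd HQ; have [W M _ _] := G.
pose I j t r' mu' := [/\ j <= m, t <= 40 * j & agree 20 r r'] /\
  [/\ pairing vx (half_edge F j) mu',
      forall i, i < j -> mu' (8 * i + 3) = ~~ F i &
      forall i, mu' (8 * i + 2) = mu (8 * i + 2)].
apply: (wp_for (I := I) (N := m) (B := 40 * m)) => //; try lia.
- move=> j t r' mu' [[jm tj A] _]; have [[? _ _ _] [_ _ _ _ ?]] := agree_consts (leqnn 20) A C.
  by split=> //; lia.
- move=> j t r' mu' u v [[jm tj A] H]; split=> //; split=> // a a20.
  by rewrite -A //; frame.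
- split; first by split.
  split=> //; split.
  + by move=> h; rewrite /half_edge ltn0.
  + by move=> v; rewrite nd.
  + by move=> h; rewrite /half_edge ltn0.
- move=> j t r' mu' jm r20 [[_ tj A] [P K1 K2]].
  apply: wp_mono (wp_pair_edge jm (agree_consts (leqnn 20) A C) _ _ r20 FE K1 K2 P);
    rewrite ?A //.
  move=> t' r2 mu2 [t40 A2 P2 K12 K22]; split; first by rewrite A2.
  split; first by split=> //; [lia | move=> a a20; rewrite A2 ?A //; lia].
  by split.
- move=> t r' mu' [[_ tm A] [P K1 K2]].
  apply: wp_mono (HQ (t + 3 * m + 3) r' mu' _ A P K1 K2) => //; lia.
Qed.

End PairingLoop.

(** * Alternating walks *)

Section Walks.
Variables (m : nat) (Z : nat -> nat -> nat) (F : pred nat) (side : nat -> bool).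
Variable M : nat -> nat.

Notation vx := (vertex_at Z).
Notation H := (half_edge F m).

(** [M] stands for the part of the memory that the walks only read: the system of paths and cycles
    stays fixed while marks and colours change. *)
Record mated : Prop := {
  mate_of : forall h, H h -> M h <> 0 ->
    [/\ H (M h), M (M h) = h, M h <> h & vx (M h) = vx h];
  unpaired_uniq : forall g h, H g -> H h -> M g = 0 -> M h = 0 ->
    vx g = vx h -> g = h }.

Hypothesis mateP : mated.
Hypothesis sideP : forall j, j < m -> side (Z j 1) = ~~ side (Z j 0).

Definition other h := 8 * (h %/ 8) + 4 + (h %% 2 == 0).

Lemma other_neq0 h : other h <> 0.
Proof. by rewrite /other; lia. Qed.

Lemma half_edge_other h : H h ->
  [/\ H (other h), other h %/ 8 = h %/ 8, other h <> h &
      side (vx (other h)) = ~~ side (vx h)].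
Proof.
rewrite /half_edge => /and3P [hm Fh h45].
have E : other h %/ 8 = h %/ 8 by rewrite /other; case: eqP; lia.
split=> //.
- by rewrite E hm Fh /other; case: eqP; lia.
- by rewrite /other; case: eqP; lia.
- rewrite /vertex_at E /other; case/orP: h45 => /eqP h8.
  + have -> : (h %% 2 == 0) = true by lia.
    have -> : h %% 4 = 0 by lia.
    by rewrite -sideP //; congr (side (Z _ _)); lia.
  + have -> : (h %% 2 == 0) = false by lia.
    have -> : h %% 4 = 1 by lia.
    by rewrite sideP // negbK; congr (side (Z _ _)); lia.
Qed.

Lemma same_edge g h : H g -> H h -> g %/ 8 = h %/ 8 -> g = h \/ g = other h.
Proof.
rewrite /half_edge /other => /and3P [_ _ g45] /and3P [_ _ h45] E.
by case/orP: g45 => /eqP g8; case/orP: h45 => /eqP h8;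
  [left|right|right|left]; try case: eqP => ?; lia.
Qed.

Definition done mu j := mu (8 * j + 3) != 0.

Definition count_done mu := \sum_(j < m) (F j && done mu j : nat).

Definition count_up mu := \sum_(j < m) (F j && done mu j) * mu (8 * j + 2).

Definition coherent mu := forall h, H h -> M h <> 0 -> done mu (h %/ 8) ->
  done mu (M h %/ 8) /\ mu (8 * (h %/ 8) + 2) + mu (8 * (M h %/ 8) + 2) = 1.

(** The invariant between walks. Its inequality says that among the coloured edges at least as many
    go up as down, which in the end keeps the total value from decreasing. *)
Definition settled mu := coherent mu /\ count_done mu <= 2 * count_up mu.

Definition paint h sgn mu :=
  upd (upd mu (8 * (h %/ 8) + 3) 1) (8 * (h %/ 8) + 2) sgn.

(* The walk entered at h0 is about to colour the edge entered at h.  Colours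
   alternate along the walk, as do the sides of the bipartition, so a closed
   walk closes consistently. *)
Record walking h0 h (sgn : nat) mu : Prop := {
  walk_half : H h;
  walk_half0 : H h0;
  walk_todo : ~~ done mu (h %/ 8);
  walk_link : forall g, H g -> M g <> 0 -> done mu (g %/ 8) ->
    [\/ g = h0, M g = h /\ h <> h0 |
        done mu (M g %/ 8) /\ mu (8 * (g %/ 8) + 2) + mu (8 * (M g %/ 8) + 2) = 1];
  walk_last : h = h0 \/
    [/\ M h <> 0, done mu (M h %/ 8) /\ mu (8 * (M h %/ 8) + 2) + sgn = 1,
        done mu (h0 %/ 8) & mu (8 * (h0 %/ 8) + 2) = 1];
  walk_side : sgn = (side (vx h) == side (vx h0));
  walk_surplus : count_done mu + (1 - sgn) <= 2 * count_up mu;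
  walk_start : M h0 = 0 \/ forall g, H g -> ~~ done mu (g %/ 8) -> M g <> 0 }.

Lemma done_paint h sgn mu j :
  done (paint h sgn mu) j = (j == h %/ 8) || done mu j.
Proof.
rewrite /done /paint upd_neq; last lia.
case: (altP (j =P h %/ 8)) => [->|jh]; first by rewrite upd_same.
by rewrite upd_neq //; lia.
Qed.

Lemma carry_paint h sgn mu j : paint h sgn mu (8 * j + 2) =
  if j == h %/ 8 then sgn else mu (8 * j + 2).
Proof.
rewrite /paint updE; case: (altP (j =P h %/ 8)) => [->|jh]; first by rewrite eqxx.
by case: eqP => [|_]; [lia | rewrite upd_neq //; lia].
Qed.

Lemma sum_change i (f g : nat -> nat) : i < m ->
  (forall j, j <> i -> f j = g j) ->
  \sum_(j < m) f j + g i = \sum_(j < m) g j + f i.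
Proof.
move=> im fg; rewrite (bigD1 (Ordinal im)) //= [in RHS](bigD1 (Ordinal im)) //=.
rewrite (eq_bigr (fun j : 'I_m => g j)); first by lia.
by move=> j ji; apply: fg => E; case/eqP: ji; apply: val_inj.
Qed.

Lemma count_done_paint h sgn mu : H h -> ~~ done mu (h %/ 8) ->
  count_done (paint h sgn mu) = (count_done mu).+1.
Proof.
rewrite /half_edge => /and3P [hm Fh _] nd; rewrite /count_done.
have := @sum_change (h %/ 8) (fun j => F j && done (paint h sgn mu) j : nat)
  (fun j => F j && done mu j : nat) hm.
rewrite /= Fh (negPf nd) done_paint eqxx /= addn0 addn1; apply.
by move=> j /eqP jh; rewrite done_paint (negPf jh).
Qed.

Lemma count_up_paint h sgn mu : H h -> ~~ done mu (h %/ 8) ->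
  count_up (paint h sgn mu) = count_up mu + sgn.
Proof.
rewrite /half_edge => /and3P [hm Fh _] nd; rewrite /count_up.
have := @sum_change (h %/ 8)
  (fun j => (F j && done (paint h sgn mu) j) * paint h sgn mu (8 * j + 2))
  (fun j => (F j && done mu j) * mu (8 * j + 2)) hm.
rewrite /= Fh (negPf nd) done_paint carry_paint eqxx /= mul0n mul1n addn0; apply.
by move=> j /eqP jh; rewrite done_paint carry_paint (negPf jh).
Qed.

(** A coloured edge met by the walk must be the one entered at [h0]: at any other coloured
    half-edge, [walk_link] makes the mate coloured too or identifies it with [h], whereas the mate
    in question is [other h] on the uncoloured current edge. *)
Lemma walking_finish h0 h sgn mu : walking h0 h sgn mu ->
  let nu := paint h sgn mu in let h' := M (other h) in
  h' = 0 \/ done nu (h' %/ 8) -> settled nu.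
Proof.
move=> [Hh Hh0 todo link last sd surp start] nu h' fin.
have [Ho Eo no so] := half_edge_other Hh.
split; last first.
  by rewrite /nu count_done_paint // count_up_paint //; clear -surp; lia.
have sgn1 : sgn <= 1 by rewrite sd; case: eqP.
(* Either the walk stops at an unpaired half-edge, or it comes back to h0. *)
have closed : h' = 0 \/ [/\ h' = h0, h <> h0 & M h0 = other h].
  case: (eqVneq h' 0) => [|/eqP h'0]; first by left.
  right; case: fin => // dn.
  have [Hh' Mh' nh' vh'] := mate_of mateP Ho h'0.
  rewrite -/h' in Hh' Mh' nh' vh'.
  have hh' : h' %/ 8 <> h %/ 8.
    move=> E; have [E'|//] := same_edge Hh' Hh E.
    by move: so; rewrite -vh' E'; case: (side _).
  move: dn; rewrite /nu done_paint => /orP [/eqP //|dn].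
  have h'0' : M h' <> 0 by rewrite Mh'; exact: other_neq0.
  have [E|[E _]|[E _]] := link _ Hh' h'0' dn.
  - by rewrite -E; split=> // E'; apply: hh'; rewrite E'.
  - by case: no; rewrite -Mh'.
  - by move: E; rewrite Mh' Eo (negPf todo).
(* A walk starts at a paired half-edge only when all uncoloured half-edges are paired, so it cannot
   stop at an unpaired one. *)
have hstart : h = h0 -> M h <> 0 -> h' <> 0.
  move=> E Mh; case: start => [|S]; first by rewrite -E.
  by apply: S; rewrite ?Eo.
move=> g Hg Mg; rewrite /nu !done_paint !carry_paint.
have hx : g = h -> M g <> 0 -> h <> h0 ->
    done mu (M g %/ 8) /\ sgn + mu (8 * (M g %/ 8) + 2) = 1.
  by move=> -> Mh hh0; case: last => // [] [_ [? ?] _ _]; split=> //; rewrite addnC.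
case: (altP (g %/ 8 =P h %/ 8)) => [gh _|gh /= dg].
  have [E|E] := same_edge Hg Hh gh; subst g.
    case: (eqVneq h h0) => [E|/eqP nE].
      case: closed => [|[_]]; last by case.
      by move=> C; have := hstart E Mg.
    have [d1 c1] := hx erefl Mg nE; rewrite d1 orbT; split=> //.
    by case: eqP => // E; rewrite E (negPf todo) in d1.
  case: closed => // [] [E nE M0]; rewrite -/h' E.
  case: last => // [] [_ _ d0 c0].
  rewrite d0 orbT; split=> //; case: eqP => [E1|_].
    by move: d0; rewrite E1 (negPf todo).
  (* [other h] is on the side opposite to [h] and, as mate of [h0], at the vertex of [h0]. So [sgn]
     is 0, against the colour 1 given to [h0]. *)
  rewrite c0 sd; have [_ _ _ vh'] := mate_of mateP Ho Mg.
  by move: so; rewrite -vh' -/h' E => ->; case: (side (vx h)).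
have [E|[E nE]|[d1 c1]] := link _ Hg Mg dg.
- subst g; case: closed => [h'0|[E nE M0]].
    exfalso; case: start => // S; case: (S _ Ho) => //; by rewrite Eo.
  rewrite M0 Eo eqxx; split=> //.
  case: last => // [] [_ _ d0 c0]; rewrite c0 sd.
  have [_ _ _ vh'] := mate_of mateP Hg Mg.
  by move: so; rewrite -M0 vh' => ->; case: (side (vx h)).
- rewrite E eqxx; split=> //.
  have [_ Mm _ _] := mate_of mateP Hg Mg.
  by case: last => // [] [_ [_ c] _ _]; rewrite -E Mm in c.
- by rewrite d1 orbT; split=> //; case: eqP => // E; rewrite E (negPf todo) in d1.
Qed.

(** Crossing an edge changes sides and passing to a mate does not, so side and colour flip together.
    The surplus demanded in [walk_surplus] is 1 after an edge rounded up and 0 after one rounded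
    down. *)
Lemma walking_continue h0 h sgn mu : walking h0 h sgn mu ->
  let nu := paint h sgn mu in let h' := M (other h) in
  h' <> 0 -> ~~ done nu (h' %/ 8) -> walking h0 h' (1 - sgn) nu.
Proof.
move=> [Hh Hh0 todo link last sd surp start] nu h' h'0 nd.
have [Ho Eo no so] := half_edge_other Hh.
have [Hh' Mh' nh' vh'] := mate_of mateP Ho h'0; rewrite -/h' in Hh' Mh' nh' vh'.
have sgn1 : sgn <= 1 by rewrite sd; case: eqP.
have o0 : other h <> 0 by exact: other_neq0.
have dh : done nu (h %/ 8) by rewrite /nu done_paint eqxx.
have ch : nu (8 * (h %/ 8) + 2) = sgn by rewrite /nu carry_paint eqxx.
have keep j : done mu j -> done nu j /\ nu (8 * j + 2) = mu (8 * j + 2).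
  move=> dj; rewrite /nu done_paint carry_paint dj orbT.
  by case: eqP => // E; rewrite E (negPf todo) in dj.
have start0 : done nu (h0 %/ 8) /\ nu (8 * (h0 %/ 8) + 2) = 1.
  case: last => [E|[_ _ d0 c0]]; first by rewrite -E dh ch sd -E eqxx.
  by have [? ->] := keep _ d0.
split=> //.
- move=> g Hg Mg; rewrite {1}/nu done_paint.
  case: (altP (g %/ 8 =P h %/ 8)) => [gh _|gh /= dg].
    have [E|E] := same_edge Hg Hh gh; subst g; last first.
      by apply: Or32; split=> // E; case: start0 => d0; rewrite -E (negPf nd) in d0.
    case: last => [->|[_ [d1 c1] _ _]]; first exact: Or31.
    have [d2 c2] := keep _ d1.
    by apply: Or33; rewrite d2 c2 ch addnC.
  have [E|[E nE]|[d1 c1]] := link _ Hg Mg dg; first exact: Or31.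
    apply: Or33; have [_ Mm _ _] := mate_of mateP Hg Mg.
    case: last => // [] [_ [d1 c1] _ _]; rewrite -E Mm in c1.
    by have [_ ->] := keep _ dg; rewrite E dh ch.
  have [d2 c2] := keep _ d1; have [_ c3] := keep _ dg.
  by apply: Or33; rewrite d2 c2 c3.
- by right; case: start0 => d0 c0; rewrite Mh' Eo dh ch; split=> //; split=> //; exact: subnKC.
- by rewrite vh' so sd; case: (side (vx h)); case: (side (vx h0)).
- by rewrite /nu count_done_paint // count_up_paint //; clear -surp sgn1; lia.
- case: start => S; [by left | right=> g Hg dg; apply: S => //].
  by apply: contra dg => /keep [].
Qed.

Definition incidence v j := (Z j 0 == v) + (Z j 1 == v).

(* At v, paired half-edges have opposite colours and at most one half-edge is
   unpaired. *)
Lemma balanced_at mu v : coherent mu -> (forall j, j < m -> F j -> done mu j) ->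
  (forall j, mu (8 * j + 2) <= 1) ->
  2 * (\sum_(j < m) F j * incidence v j * mu (8 * j + 2))
    <= \sum_(j < m) F j * incidence v j + 1.
Proof.
move=> coh all_done bits.
pose addr (p : 'I_m * bool) := 8 * p.1 + 4 + p.2.
have addr8 p : addr p %/ 8 = p.1 by rewrite /addr; case: p => j []; rewrite /=; lia.
have vaddr p : vx (addr p) = Z p.1 p.2.
  by rewrite /addr vertex_atE //; case: p.2.
(* [f] is passage to the mate, in terms of pairs of an edge and an end. The default of [insubd] does
   not occur for paired half-edges. *)
pose f p := (insubd p.1 (M (addr p) %/ 8), M (addr p) %% 8 == 5) : 'I_m * bool.
pose P (p : 'I_m * bool) := F p.1 && (Z p.1 p.2 == v).
have HP p : P p -> H (addr p).
  rewrite /P /half_edge addr8 ltn_ord => /andP [-> _] /=.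
  by rewrite /addr; case: p.2 => /=; lia.
have addr_inj p q : addr p = addr q -> p = q.
  move=> E; have E1 : p.1 = q.1 by apply: val_inj; rewrite /= -!addr8 E.
  case: p q E E1 => [i a] [j b]; rewrite /addr /= => E E1; subst j.
  by congr pair; move: E => /addnI; case: a; case: b.
have fA p : H (M (addr p)) -> addr (f p) = M (addr p).
  rewrite /half_edge => /and3P [Mm FM M45].
  rewrite {1}/addr /f /= val_insubd Mm.
  by case/orP: M45 => /eqP M8; rewrite M8 /=; lia.
have fP p : P p -> M (addr p) <> 0 -> [/\ addr (f p) = M (addr p),
    P (f p), M (addr (f p)) <> 0 & f (f p) = p].
  move=> Pp M0; have Hp := HP _ Pp; have [HM MM _ vM] := mate_of mateP Hp M0.
  have Ea := fA _ HM.
  have Ma : M (addr (f p)) = addr p by rewrite Ea.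
  split=> //.
  - rewrite /P -vaddr Ea vM vaddr; case/andP: Pp => _ ->; rewrite andbT.
    by move: HM; rewrite -Ea /half_edge addr8 => /and3P [].
  - by rewrite Ma /addr; lia.
  - by apply: addr_inj; rewrite fA Ma.
have sumE (g : nat -> nat) :
    \sum_(j < m) F j * incidence v j * g j = \sum_(p | P p) g p.1.
  have -> : \sum_(p | P p) g p.1 =
      \sum_(j < m) \sum_(b : bool) if P (j, b) then g j else 0.
    by rewrite pair_bigA big_mkcond; apply: eq_bigr => [[j b]].
  apply: eq_bigr => j _; rewrite big_bool /P /incidence /=.
  by case: (F j); case: eqP; case: eqP => _ _ /=; lia.
have sum1 : \sum_(j < m) F j * incidence v j = \sum_(p | P p) 1.
  by rewrite -(sumE (fun=> 1)); apply: eq_bigr => j _; rewrite muln1.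
rewrite (sumE (fun j => mu (8 * j + 2))) sum1.
rewrite (bigID (fun p => M (addr p) != 0)) [in X in _ <= X](bigID (fun p => M (addr p) != 0)) /=.
set A := \sum_(p | _ && (_ != 0)) _; set B := \sum_(p | _ && ~~ _) _.
set A1 := \sum_(p | _ && (_ != 0)) _; set B1 := \sum_(p | _ && ~~ _) _.
(* The involution [f] permutes the paired half-edges at [v]; adding both forms of the sum puts every
   colour next to its complement. *)
have EA : A = \sum_(p | P p && (M (addr p) != 0)) mu (8 * (f p).1 + 2).
  rewrite /A (reindex_onto f f) /=; last by move=> p /andP [Pp /eqP M0]; have [] := fP p Pp M0.
  apply: eq_bigl => p; apply/idP/idP.
    move=> /andP [/andP [Pf /eqP Mf] /eqP <-]; have [_ -> /eqP -> _] := fP _ Pf Mf.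
    by [].
  by move=> /andP [Pp /eqP Mp]; have [_ -> /eqP -> ->] := fP _ Pp Mp; rewrite eqxx.
have E2 : 2 * A = A1.
  rewrite mul2n -addnn {2}EA -big_split /=; apply: eq_bigr => p /andP [Pp /eqP Mp].
  have [Ea _ _ _] := fP _ Pp Mp.
  have d : done mu (addr p %/ 8) by rewrite addr8; apply: all_done => //; case/andP: Pp.
  by have [_ E] := coh _ (HP _ Pp) Mp d; rewrite -Ea !addr8 in E.
suff : 2 * B <= B1 + 1 by lia.
(* At most one half-edge at [v] is unpaired; it accounts for the additional 1. *)
case: (pickP (fun p => P p && ~~ (M (addr p) != 0))) => [p0 /andP [Pp0 /negPn /eqP M0]|none];
  last by rewrite /B big_pred0.
have E3 p : (P p && ~~ (M (addr p) != 0)) = (p == p0).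
  apply/idP/eqP => [/andP [Pp /negPn /eqP Mp]|->]; last by rewrite Pp0 M0.
  apply: addr_inj; apply: (unpaired_uniq mateP (HP _ Pp) (HP _ Pp0) Mp M0).
  by rewrite !vaddr; case/andP: Pp => _ /eqP ->; case/andP: Pp0 => _ /eqP ->.
rewrite /B /B1 !(big_pred1 p0) //.
by move: (bits p0.1); case: (mu _) => [|[|]].
Qed.

End Walks.

(** * Execution and cost of the walks *)

Definition extends mu nu :=
  (forall a, a %% 8 <> 2 -> a %% 8 <> 3 -> nu a = mu a) /\
  (forall j, done mu j -> done nu j /\ nu (8 * j + 2) = mu (8 * j + 2)).

Lemma extends_trans mu nu xi : extends mu nu -> extends nu xi -> extends mu xi.
Proof.
move=> [A1 D1] [A2 D2]; split=> [a a2 a3|j /D1 [/D2 [d c] c']].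
  by rewrite A2 ?A1.
by rewrite c.
Qed.

Lemma extends_paint h sgn mu : ~~ done mu (h %/ 8) -> extends mu (paint h sgn mu).
Proof.
move=> nd; split=> [a a2 a3|j dj].
  by rewrite /paint !upd_neq //; lia.
rewrite done_paint carry_paint dj orbT; split=> //.
by case: eqP => // E; rewrite -E dj in nd.
Qed.

Lemma extends_half mu nu g : extends mu nu -> half_address g -> nu g = mu g.
Proof. by move=> [E _]; rewrite /half_address => g45; apply: E; lia. Qed.

Section WalkProgram.
Variables (w : nat) (inp : nat -> nat -> nat) (m : nat) (Z : nat -> nat -> nat).
Hypothesis G : graph_input w inp m Z.
Variables (F : pred nat) (side : nat -> bool) (M : nat -> nat).
Hypothesis mateP : mated m Z F M.
Hypothesis sideP : forall j, j < m -> side (Z j 1) = ~~ side (Z j 0).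

Notation wp := (wp w inp).
Notation H := (half_edge F m).
Notation settled := (settled m F M).
Notation walking := (walking m Z F side M).

Lemma wp_walk_step h0 h sgn r mu : consts m r -> r 24 = h -> r 30 = sgn ->
  (forall g, half_address g -> mu g = M g) -> walking h0 h sgn mu ->
  let h' := M (other h) in
  wp walk_step (fun t r' mu' => [/\ t <= 18, agree 24 r r', mu' = paint h sgn mu &
    [/\ r' 31 = 1, r' 24 = h', r' 30 = 1 - sgn, h' <> 0 & ~~ done mu' (h' %/ 8)] \/
    (r' 31 = 0 /\ (h' = 0 \/ done mu' (h' %/ 8)))]) r mu.
Proof.
move=> C r24 r30 mates W h'.
have [[r1 r2 r3 r4] [r6 r14 r15 r16 r5]] := C.
have [W8 M8 _ _] := G.
have Hh := walk_half W; have [Ho Eo _ _] := @half_edge_other m Z F side sideP h Hh.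
have sgn1 : sgn <= 1 by rewrite (walk_side W); case: eqP.
have hm : h %/ 8 < m by case/and3P: Hh.
apply: (@wp_op _ _ (h %/ 8)); first by lookup.
apply: (@wp_op _ _ (8 * (h %/ 8))); first by word.
apply: (@wp_op _ _ (8 * (h %/ 8) + 3)); first by word.
apply: (@wp_write _ _ (8 * (h %/ 8) + 3) 1); [by lookup|by lookup|].
apply: (@wp_op _ _ (8 * (h %/ 8) + 2)); first by word.
apply: (@wp_write _ _ (8 * (h %/ 8) + 2) sgn); [by lookup|by lookup|].
rewrite -/(paint h sgn mu); set nu := paint h sgn mu.
have ho := half_edge_addr Ho.
have Eh' : nu (other h) = h'.
  exact: etrans (extends_half (extends_paint sgn (walk_todo W)) ho) (mates _ ho).
apply: (@wp_op _ _ (1 - sgn)).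
  by lookup; case: (sgn) sgn1 => [|[]].
apply: (@wp_op _ _ (h %% 2)); first by lookup.
apply: (@wp_op _ _ (h %% 2 == 0)); first by lookup.
apply: (@wp_op _ _ (8 * (h %/ 8) + 4)); first by word.
apply: (@wp_op _ _ (other h)).
  by lookup; rewrite /eval_binop /other modn_small //; case: (h %% 2 == 0); lia.
apply: (@wp_read _ _ h'); first by lookup.
apply: (@wp_if _ _ h'); first by lookup.
case: (eqVneq h' 0) => [E|/eqP h'0] /=.
  apply: wp_const; first lia.
  apply: wp_nil; split; [by []|by move=> a a24; frame|by []|].
  by right; split=> //; left.
have [Hh' _ _ _] := mate_of mateP Ho h'0; rewrite -/h' in Hh'.
have hm' : h' %/ 8 < m by case/and3P: Hh'.
apply: (@wp_op _ _ (h' %/ 8)); first by lookup.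
apply: (@wp_op _ _ (8 * (h' %/ 8))); first by word.
apply: (@wp_op _ _ (8 * (h' %/ 8) + 3)); first by word.
apply: (@wp_read _ _ (nu (8 * (h' %/ 8) + 3))); first by lookup.
apply: (@wp_op _ _ (~~ done nu (h' %/ 8))).
  by lookup; rewrite /done negbK.
apply: wp_nil; split; [by []|by move=> a a24; frame|by []|].
case D: (done nu (h' %/ 8)); last by left.
by right; split=> //; right.
Qed.

Lemma count_done_le mu : count_done m F mu <= m.
Proof.
rewrite /count_done -[X in _ <= X]card_ord -sum1_card.
by apply: leq_sum => i _; case: (_ && _).
Qed.

(** Each round takes at most 18 steps and a test, and colours one new edge. Counting 19 steps per
    coloured edge bounds the time and, since only [m] edges exist, gives termination. *)
Lemma wp_walk h0 q Q r mu : consts m r -> r 24 = h0 -> r 30 = 1 -> r 31 = 1 ->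
  (forall g, half_address g -> mu g = M g) ->
  (forall j, mu (8 * j + 2) <= 1) -> walking h0 h0 1 mu ->
  (forall t r' mu', t + 19 * count_done m F mu <= 19 * count_done m F mu' + 1 ->
     agree 24 r r' -> settled mu' -> extends mu mu' ->
     (forall j, mu' (8 * j + 2) <= 1) -> done mu' (h0 %/ 8) ->
     wp q (fun t' => Q (t + t')) r' mu') ->
  wp (While 31 walk_step :: q) Q r mu.
Proof.
move=> C r24 r30 r31 mates bits W HQ.
pose J t r' mu' := [/\ t + 19 * count_done m F mu <= 19 * count_done m F mu',
    agree 24 r r', extends mu mu', forall j, mu' (8 * j + 2) <= 1 &
    [/\ r' 31 = 1, walking h0 (r' 24) (r' 30) mu' & mu' = mu \/ done mu' (h0 %/ 8)] \/
    [/\ r' 31 = 0, settled mu' & done mu' (h0 %/ 8)]].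
apply: (wp_while (I := J) (B := 19 * m)).
- by split=> //; left; split; rewrite ?r24 ?r30 //; left.
- by move=> t r' mu' [tb _ _ _ _]; have := count_done_le mu'; lia.
- move=> t r' mu' [tb A E b1 [[r31' W' d0]|[-> //]]] _.
  have A20 : agree 20 r r' by move=> a a20; apply: A; lia.
  have mates' g : half_address g -> mu' g = M g.
    by move=> hg; rewrite (extends_half E hg) mates.
  have sgn1 : r' 30 <= 1 by rewrite (walk_side W'); case: eqP.
  apply: wp_mono (wp_walk_step (agree_consts (leqnn 20) A20 C) erefl erefl mates' W').
  move=> t' r2 mu2 [t18 A2 E2 S].
  have D0 : done mu2 (h0 %/ 8).
    case: d0 => [E0|d0]; last by rewrite E2 done_paint d0 orbT.
    case: (walk_last W') => [E3|[_ _ d1 _]].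
      by rewrite E2 done_paint E3 eqxx.
    by have := walk_todo W; rewrite -E0 d1.
  split.
  + rewrite E2 count_done_paint; [lia|exact: walk_half W'|exact: walk_todo W'].
  + exact: agree_trans (leqnn _) A A2.
  + by rewrite E2; apply: extends_trans E (extends_paint _ (walk_todo W')).
  + by move=> j; rewrite E2 carry_paint; case: eqP.
  + case: S => [[r31'' r24'' r30'' n0 nd]|[r31'' fin]].
      left; rewrite r24'' r30''; split=> //; last by right.
      by rewrite E2 in nd *; apply: (@walking_continue m Z F side M mateP sideP) W' n0 nd.
    right; split=> //; rewrite E2 in fin *; exact: (@walking_finish m Z F side M mateP sideP) W' fin.
- move=> t r' mu' [tb A E b1 [[-> //]|[r31' S D0 _]]].
  apply: wp_mono (HQ t.+1 r' mu' _ A S E b1 D0) => //; lia.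
Qed.

(** The walks of a pass colour disjoint sets of edges, so 19 [m] steps pay for all of them together;
    each edge adds at most 14 steps for its test and 3 for the loop. *)
Lemma wp_walk_pass s kb kf q Q r mu : s < 2 -> kb < 20 -> kf < 20 ->
  r kb = 4 + s -> r kf <= 1 -> consts m r ->
  (forall g, half_address g -> mu g = M g) ->
  (forall j, mu (8 * j + 2) <= 1) -> settled mu ->
  (forall j, j < m -> ~~ F j -> done mu j) ->
  (r kf = 1 -> forall g, H g -> ~~ done mu (g %/ 8) -> M g <> 0) ->
  (forall t r' mu', t <= 36 * m + 3 -> agree 20 r r' -> settled mu' ->
     extends mu mu' -> (forall j, mu' (8 * j + 2) <= 1) ->
     (forall j, j < m -> M (8 * j + 4 + s) = 0 \/ r kf = 1 -> done mu' j) ->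
     wp q (fun t' => Q (t + t')) r' mu') ->
  wp (for_loop 5 (walk_from kb kf) ++ q) Q r mu.
Proof.
move=> s2 kb20 kf20 rb rf C mates bits S nF start HQ; have [W M8 _ _] := G.
pose I j t r' mu' := [/\ j <= m, agree 20 r r', extends mu mu', settled mu' &
    forall j, mu' (8 * j + 2) <= 1] /\
  [/\ t + 19 * count_done m F mu <= 14 * j + 19 * count_done m F mu' &
    forall i, i < j -> M (8 * i + 4 + s) = 0 \/ r kf = 1 -> done mu' i].
apply: (wp_for (I := I) (N := m) (B := 33 * m)) => //; try lia.
- move=> j t r' mu' [[jm A _ _ _] [tj _]].
  have [[? _ _ _] [_ _ _ _ ?]] := agree_consts (leqnn 20) A C.
  by split=> //; have := count_done_le mu'; lia.
- move=> j t r' mu' u v [[jm A E S' b1] [tj D]]; split=> //; split=> // a a20.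
  by rewrite -A //; frame.
- move=> j t r' mu' jm r20 [[_ A E S' b1] [tj D]].
  have C1 := agree_consts (leqnn 20) A C; have [[r1 r2 r3 r4] [r6 r14 r15 r16 r5]] := C1.
  have rb' : r' kb = 4 + s by rewrite A.
  have mates' g : half_address g -> mu' g = M g.
    by move=> hg; rewrite (extends_half E hg) mates.
  have hh : half_address (8 * j + 4 + s) by rewrite /half_address; lia.
  apply: (@wp_op _ _ (8 * j)); first by word.
  apply: (@wp_op _ _ (8 * j + 3)); first by word.
  apply: (@wp_read _ _ (mu' (8 * j + 3))); first by lookup.
  apply: (@wp_op _ _ (8 * j + 4 + s)).
    have -> : forall x1 x2 x3, upd (upd (upd r' 22 x1) 23 x2) 23 x3 kb = r' kb.
      by move=> *; frame.
    by word.
  apply: (@wp_read _ _ (M (8 * j + 4 + s))); first by lookup; exact: mates'.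
  apply: (@wp_op _ _ (M (8 * j + 4 + s) == 0)); first by lookup.
  apply: (@wp_op _ _ ((M (8 * j + 4 + s) == 0) + r kf)).
    set r2' := upd (upd _ _ _) 25 _.
    have -> : r2' kf = r kf by rewrite /r2' -A //; frame.
    by rewrite /r2'; lookup; rewrite /eval_binop modn_small //; case: (M _ == 0); lia.
  apply: (@wp_op _ _ (~~ done mu' j)); first by lookup; rewrite /done negbK.
  set c := (M (8 * j + 4 + s) == 0) + r kf.
  apply: (@wp_op _ _ (c * ~~ done mu' j)).
    lookup; rewrite /eval_binop modn_small // /c.
    by case: (M _ == 0); case: (done _ _); lia.
  apply: (@wp_if _ _ (c * ~~ done mu' j)); first by lookup.
  have [E0|E1] := altP (c * ~~ done mu' j =P 0).
    apply: wp_nil; split; first by lookup.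
    split.
      by split=> //; move=> a a20; rewrite -A //; frame.
    split; first by lia.
    move=> i; rewrite ltnS leq_eqVlt => /orP [/eqP -> Hi|]; last exact: D.
    have c0 : c <> 0 by rewrite /c; case: Hi => ->; lia.
    by case: (done mu' j) E0 => //=; lia.
  have nd : ~~ done mu' j by case: (done mu' j) E1 => //=; rewrite muln0.
  have c0 : M (8 * j + 4 + s) = 0 \/ r kf = 1.
    by move: E1; rewrite nd /c; case: (M _ =P 0) => /=; [left|right; lia].
  have Fj : F j.
    apply/negPn/negP => /(nF _ jm) /(E.2 _) [dj _]; by rewrite dj in nd.
  have h8 : (8 * j + 4 + s) %/ 8 = j by lia.
  have Hh : H (8 * j + 4 + s) by rewrite /half_edge h8 jm Fj.
  apply: wp_const; first lia.
  apply: wp_const; first lia.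
  apply: (wp_walk (h0 := 8 * j + 4 + s)) => //.
  + split=> //; rewrite ?h8 //.
    * by move=> g Hg Mg dg; apply: Or33; exact: S'.1 Hg Mg dg.
    * by left.
    * by rewrite eqxx.
    * by rewrite subnn addn0; exact: S'.2.
    * case: c0 => [|f1]; first by left.
      right=> g Hg dg; apply: start => //; apply: contra dg => dg.
      by have [] := E.2 _ dg.
  + move=> t' r2' mu2 tb A2 S2 E2 b2 d2; rewrite h8 in d2.
    apply: wp_nil; split; first by rewrite A2 //; lookup.
    split.
      split=> //; last exact: extends_trans E E2.
      by move=> a a20; rewrite A2; [rewrite -(A a a20); frame|lia].
    split; first by lia.
    move=> i; rewrite ltnS leq_eqVlt => /orP [/eqP -> //|ij] /(D _ ij) di.
    by have [] := E2.2 _ di.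
- move=> t r' mu' [[_ A E S' b1] [tj D]].
  apply: wp_mono (HQ (t + 3 * m + 3) r' mu' _ A S' E b1 D) => //.
  have := count_done_le mu'; lia.
Qed.

End WalkProgram.

(** * One level of the rounding *)

Section Level.
Variables (w : nat) (inp : nat -> nat -> nat) (m : nat) (Z : nat -> nat -> nat).
Hypothesis G : graph_input w inp m Z.
Variable side : nat -> bool.
Hypothesis sideP : forall j, j < m -> side (Z j 1) = ~~ side (Z j 0).

Notation wp := (wp w inp).

Definition clean mu := no_dangling mu /\ forall j, mu (8 * j + 2) <= 1.

Lemma wp_split_level D k mask q Q r mu : k + 2 < 2 ^ w ->
  (forall j, j < m -> (inp (j + 2) (k + 2) %/ mask) %% 2 = D j) ->
  consts m r -> r 9 = k -> r 10 = mask -> clean mu ->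
  let F j := D j != mu (8 * j + 2) in
  (forall t r' mu', t <= 163 * m + 15 -> agree 20 r r' -> clean mu' ->
    (forall j, j < m -> ~~ F j -> mu' (8 * j + 2) = mu (8 * j + 2)) ->
    (forall v, 2 * (\sum_(j < m) F j * incidence Z v j * mu' (8 * j + 2))
       <= \sum_(j < m) F j * incidence Z v j + 1) ->
    \sum_(j < m) F j <= 2 * (\sum_(j < m) F j * mu' (8 * j + 2)) ->
    wp q (fun t' => Q (t + t')) r' mu') ->
  wp (split_level ++ q) Q r mu.
Proof.
move=> k2 D_bit C r9 r10 [nd bits] F HQ.
rewrite /split_level -!catA.
apply: (wp_pair_loop G k2 D_bit C r9 r10 (F := F)) => // t1 r1 mu1 tb1 A1 P1 mark1 carry1.
have C1 := agree_consts (leqnn 20) A1 C.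
apply: (wp_reset_loop G C1).
  move=> v v0; have [Hd <- _] := pairing_dangling P1 v0.
  exists (mu1 (8 * v + 7) %/ 8), (mu1 (8 * v + 7) %% 4).
  by split=> //; [case/and3P: Hd | have := half_edge_addr Hd; rewrite /half_address; lia].
move=> t2 r2 mu2 tb2 A2 nd2 same2.
have A12 := agree_trans (leqnn _) A1 A2.
have C2 := agree_consts (leqnn 20) A2 C1.
(* From here on only marks and carries change, so the mates can be frozen. *)
pose M h := mu2 h.
have same_half h : half_address h -> mu2 h = mu1 h.
  by move=> hh; apply: same2; move: hh; rewrite /half_address; lia.
have mateP : mated m Z F M.
  split=> [h Hh|g h Hg Hh]; rewrite /M.
    rewrite !(same_half h (half_edge_addr Hh)) => h0.
    have [a b c d] := pairing_mate P1 Hh h0.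
    by rewrite (same_half _ (half_edge_addr a)).
  rewrite (same_half g (half_edge_addr Hg)) (same_half h (half_edge_addr Hh)) => g0 h0 E.
  by rewrite -(pairing_free P1 Hg g0) E; exact: (pairing_free P1 Hh h0).
have done2 j : j < m -> done mu2 j = ~~ F j.
  move=> jm; rewrite /done same2; last lia.
  by rewrite mark1 //; case: (F j).
have bits2 j : mu2 (8 * j + 2) <= 1 by rewrite same2 ?carry1 //; lia.
have S2 : settled m F M mu2.
  split=> [h /and3P [hm Fh _] _|]; first by rewrite done2 // Fh.
  by rewrite /count_done big1 // => j _; rewrite done2 //; case: (F j).
have nF2 j : j < m -> ~~ F j -> done mu2 j by move=> jm; rewrite done2.
have [[_ _ _ r24] [_ _ r215 r216 _]] := C2.
have [r21 _ _ _] := C2.1.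
apply: (@wp_walk_pass w inp m Z G F side M mateP sideP 0 4 15) => //; rewrite ?r215 //.
move=> t3 r3 mu3 tb3 A3 S3 E3 bits3 K3.
have C3 := agree_consts (leqnn 20) A3 C2.
have [[_ _ _ r34] [_ _ r315 r316 _]] := C3.
apply: (@wp_walk_pass w inp m Z G F side M mateP sideP 1 16 15) => //; rewrite ?r315 //.
  by move=> g hg; rewrite (extends_half E3 hg).
  by move=> j jm /(nF2 _ jm) /(E3.2 _) [].
move=> t4 r4 mu4 tb4 A4 S4 E4 bits4 K4.
have C4 := agree_consts (leqnn 20) A4 C3.
have [[r41 _ _ r44] _] := C4.
have E24 := extends_trans E3 E4.
apply: (@wp_walk_pass w inp m Z G F side M mateP sideP 0 4 1) => //; rewrite ?r41 //.
  by move=> g hg; rewrite (extends_half E24 hg).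
  by move=> j jm /(nF2 _ jm) /(E24.2 _) [].
  (* An uncoloured unpaired half-edge would have been a starting point of the first or the second
     pass, according to its end. *)
  move=> _ g /and3P [gm Fg g45] ndg M0; case/negP: ndg.
  case/orP: g45 => /eqP g8.
    have d : done mu3 (g %/ 8).
      by apply: K3 => //; left; rewrite -[RHS]M0; congr M; lia.
    by have [] := E4.2 _ d.
  by apply: K4 => //; left; rewrite -[RHS]M0; congr M; lia.
move=> t5 r5 mu5 tb5 A5 S5 E5 bits5 K5.
have E25 := extends_trans E24 E5.
have done5 j : j < m -> done mu5 j by move=> jm; apply: K5 => //; right.
apply: wp_mono (HQ (t1 + t2 + t3 + t4 + t5) r5 mu5 _ _ _ _ _ _).
- by move=> t r' mu' ; rewrite !addnA.
- lia.
- by apply: agree_trans A5 => //; apply: agree_trans A4 => //; apply: agree_trans A3.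
- by split=> // v; rewrite E25.1 //; lia.
- move=> j jm nFj; have [_ ->] := E25.2 _ (nF2 _ jm nFj).
  by rewrite same2 ?carry1 //; lia.
- by move=> v; apply: (balanced_at mateP v S5.1) => // j jm _; exact: done5.
- have -> : \sum_(j < m) F j = count_done m F mu5.
    by apply: eq_bigr => j _; rewrite done5 // andbT.
  have -> : \sum_(j < m) F j * mu5 (8 * j + 2) = count_up m F mu5.
    by apply: eq_bigr => j _; rewrite done5 // andbT.
  exact: S5.2.
Qed.

End Level.

(** * Reading bits *)

(* The bit of weight 2^-i is the p-th bit of the digit k. *)
Definition position w i k mask :=
  exists p, [/\ p < w, w * k = i + p & mask = 2 ^ p].

Lemma position0 w : 0 < w -> position w 0 0 1.
Proof. by move=> w0; exists 0; rewrite muln0. Qed.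

Lemma position_le w i k mask : position w i k mask -> k <= i.
Proof.
move=> [p [pw E _]]; rewrite leqNgt; apply/negP => ik.
have : w * i.+1 <= w * k by rewrite leq_mul2l ik orbT.
by rewrite E; nia.
Qed.

(* f i is the integer part of y 2^i for some real y >= 0. *)
Definition binary (f : nat -> nat) := forall i, f i.+1 %/ 2 = f i.

Lemma binary_shift f i p : binary f -> f (i + p) %/ 2 ^ p = f i.
Proof.
move=> bf; elim: p => [|p IH]; first by rewrite addn0 divn1.
by rewrite addnS expnS divnMA bf.
Qed.

Lemma binary_bit w f i k mask : binary f -> position w i k mask ->
  (f (w * k) %% 2 ^ w) %/ mask %% 2 = f i %% 2.
Proof.
move=> bf [p [pw -> ->]].
have -> : 2 ^ w = 2 ^ (w - p) * 2 ^ p by rewrite -expnD subnK // ltnW.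
rewrite -modn_divl binary_shift //.
(* The lowest remaining bit survives the reduction modulo [2^(w-p)] because [p < w]. *)
by rewrite modn_dvdm // -[X in X %| _]expn1 dvdn_exp2l // subn_gt0.
Qed.

Definition leading (f : nat -> nat) l :=
  f l %% 2 = 1 /\ forall i, i < l -> f i %% 2 = 0.

Section Bits.
Variables (w : nat) (inp : nat -> nat -> nat) (m : nat).
Hypothesis w_large : 8 <= w.

Notation wp := (wp w inp).

Lemma word_gt : 256 <= 2 ^ w.
Proof. by apply: leq_trans (leq_pexp2l (isT : 0 < 2) w_large). Qed.

Lemma wp_next_bit kr mr i r mu : 8 < kr -> 8 < mr -> kr <> mr ->
  kr <> 15 -> mr <> 15 ->
  consts m r -> r 8 = 2 ^ w.-1 -> position w i (r kr) (r mr) -> i.+1 < 2 ^ w ->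
  wp (next_bit kr mr) (fun t r' mu' => [/\ t <= 4, mu' = mu,
    position w i.+1 (r' kr) (r' mr) &
    forall a, a <> kr -> a <> mr -> r' a = r a]) r mu.
Proof.
move=> kr8 mr8 kmr k15 m15 [[r1 r2 r3 r4] [r6 r14 r15 r16 r5]] r8 pos iw.
have kle := position_le pos; have W := word_gt.
case: pos => p [pw E Em].
have u2 a v : a <> mr -> upd r mr v a = r a by move=> n; rewrite upd_neq.
apply: (@wp_op _ _ (2 ^ p %/ 2)).
  by rewrite r2 Em.
apply: (@wp_if _ _ (2 ^ p %/ 2)); first by rewrite upd_same.
case: p pw E Em => [|p] pw E Em /=.
  apply: (@wp_op _ _ (2 ^ w.-1)).
    rewrite !u2; try lia.
    rewrite r8 r15 /eval_binop addn0 modn_small // ltn_exp2l //; lia.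
  apply: (@wp_op _ _ (r kr).+1).
    rewrite !upd_neq; try lia.
    by rewrite r1 /eval_binop addn1 modn_small //; lia.
  apply: wp_nil; split=> //; last by move=> a ak am; rewrite !upd_neq.
  rewrite upd_same upd_neq; last by apply: nesym.
  by rewrite upd_same; exists w.-1; split; nia.
have E2 : 2 ^ p.+1 %/ 2 = 2 ^ p by rewrite expnS mulKn.
rewrite E2 -lt0n expn_gt0 /=.
apply: wp_nil; split=> //; last by move=> a ak am; rewrite !upd_neq.
rewrite upd_same upd_neq; last by [].
by exists p; split; lia.
Qed.

Lemma wp_previous_bit i r mu : consts m r -> position w i.+1 (r 9) (r 10) ->
  i.+2 < 2 ^ w ->
  wp previous_bit (fun t r' mu' => [/\ t <= 4, mu' = mu,
    position w i (r' 9) (r' 10) &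
    forall a, a <> 9 -> a <> 10 -> r' a = r a]) r mu.
Proof.
move=> [[r1 r2 r3 r4] [r6 r14 r15 r16 r5]] pos iw.
have kle := position_le pos; have W := word_gt.
case: pos => p [pw E Em].
have k0 : 0 < r 9 by case: (r 9) E => //; rewrite muln0.
case: (ltnP p.+1 w) => pw'.
  apply: (@wp_op _ _ (2 ^ p.+1)).
    by rewrite Em /eval_binop addnn -mul2n -expnS modn_small // ltn_exp2l.
  apply: (@wp_if _ _ (2 ^ p.+1)); first by lookup.
  rewrite -lt0n expn_gt0 /=; apply: wp_nil; split=> //.
    by lookup; exists p.+1; split=> //; lia.
  by move=> a a9 a10; rewrite upd_neq.
have Ew : w = p.+1 by lia.
apply: (@wp_op _ _ 0).
  by rewrite Em /eval_binop addnn -mul2n -expnS -Ew modnn.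
apply: (@wp_if _ _ 0); first by lookup.
rewrite /=; apply: wp_const; first lia.
apply: (@wp_op _ _ (r 9).-1).
  lookup; have -> : r 9 + 2 ^ w - 1 = (r 9).-1 + 2 ^ w by lia.
  by rewrite modnDr modn_small //; lia.
apply: wp_nil; split=> //; last by move=> a a9 a10; rewrite !upd_neq.
lookup; exists 0; split=> //; first lia.
by case: (r 9) k0 E => // k _; rewrite mulnS; lia.
Qed.

Lemma wp_leading_bit f l row off q Q r mu : binary f -> leading f l ->
  off <= 2 -> l + 4 < 2 ^ w ->
  (forall k, inp row (k + off) = f (w * k) %% 2 ^ w) ->
  consts m r -> r 8 = 2 ^ w.-1 -> r 22 = row -> r 23 = off ->
  (forall t r', t <= 11 * l + 16 -> agree 24 r r' -> r' 24 = l ->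
     wp q (fun t' => Q (t + t')) r' mu) ->
  wp (leading_bit ++ q) Q r mu.
Proof.
move=> bf [lead1 lead0] off2 lw inpE C r8 r22 r23 HQ; have W := word_gt.
apply: wp_const; first lia.
apply: wp_const; first lia.
apply: wp_const; first lia.
apply: wp_const; first lia.
set r0 := upd _ _ _.
pose J t r' mu' := [/\ mu' = mu, agree 24 r r', r' 24 <= l,
    position w (r' 24) (r' 25) (r' 26) &
    (r' 27 = 1 /\ t <= 11 * r' 24) \/ [/\ r' 27 = 0, r' 24 = l & t <= 11 * l + 11]].
apply: (wp_while (I := J) (B := 11 * l + 11)).
- split=> //.
  + by move=> a a24; rewrite /r0; frame.
  + by rewrite /r0; lookup; apply: position0; lia.
  + by left; rewrite /r0; lookup.
- by move=> t r' mu' [_ _ le _ [[_]|[_ _]]]; lia.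
- move=> t r' mu' [-> A le pos [[r27 tb]|[-> //]]] _.
  have A20 : agree 20 r r' by move=> a a20; apply: A; lia.
  have C' := agree_consts (leqnn 20) A20 C.
  have [[r'1 r'2 r'3 r'4] [r'6 r'14 r'15 r'16 r'5]] := C'.
  have r'8 : r' 8 = 2 ^ w.-1 by rewrite A.
  have r'22 : r' 22 = row by rewrite A.
  have r'23 : r' 23 = off by rewrite A.
  have kle := position_le pos.
  apply: (@wp_op _ _ (r' 25 + off)); first by word.
  apply: (@wp_input _ _ (f (w * r' 25) %% 2 ^ w)); first by lookup.
  apply: (@wp_op _ _ ((f (w * r' 25) %% 2 ^ w) %/ r' 26)); first by lookup.
  apply: (@wp_op _ _ (f (r' 24) %% 2)).
    by lookup; exact: binary_bit.
  apply: (@wp_if _ _ (f (r' 24) %% 2)); first by lookup.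
  set r1 := upd _ 28 (_ %% 2).
  have A1 a : a <> 28 -> r1 a = r' a by move=> a28; rewrite /r1; frame.
  have C1 : consts m r1 by move: C'; rewrite /consts !A1.
  case: (ltnP (r' 24) l) => il.
    rewrite lead0 //=.
    have pos1 : position w (r1 24) (r1 25) (r1 26) by rewrite !A1.
    have r18 : r1 8 = 2 ^ w.-1 by rewrite A1.
    apply: (@wp_cat _ _ (next_bit 25 26) [:: Do (Op Add 24 24 1)]).
    apply: wp_mono (@wp_next_bit 25 26 (r1 24) r1 mu _ _ _ _ _ C1 r18 pos1 _) => //;
      last by rewrite A1; lia.
    move=> t' r2 mu2 [t4 -> pos2 A2].
    have r21 : r2 1 = 1 by rewrite A2 ?A1.
    have r224 : r2 24 = r' 24 by rewrite A2 ?A1.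
    apply: (@wp_op _ _ (r' 24).+1).
      by lookup; rewrite /eval_binop addn1 modn_small //; lia.
    apply: wp_nil; split=> //.
    + by move=> a a24; rewrite upd_neq ?A2 ?A1 ?A //; lia.
    + by left; lookup; rewrite A2 ?A1 //; lia.
  have El : r' 24 = l by lia.
  rewrite El lead1 /=; apply: wp_const; first lia.
  apply: wp_nil; split=> //.
  + by move=> a a24; rewrite upd_neq ?A1 ?A //; lia.
  + by right; split=> //; lia.
- move=> t r' mu' [-> A le pos [[-> //]|[_ El tb]]] _.
  apply: wp_mono (HQ (t + 5) r' _ A El); last lia.
  by move=> t' r2 mu2; congr Q; lia.
Qed.

End Bits.

(** * Rounding all levels *)

Section Levels.
Variables (m : nat) (Z : nat -> nat -> nat) (X : nat -> nat -> nat).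

Definition value i mu j := X j i + mu (8 * j + 2).

Definition feasible i mu :=
  forall v, \sum_(j < m) incidence Z v j * value i mu j <= 2 ^ i.

(* A vertex load that is a multiple of 2^-i and exceeds 1 by at most 2^-(i+1)
   does not exceed 1. *)
Lemma level_step i mu mu' : (forall j, j < m -> binary (X j)) ->
  (forall j, mu (8 * j + 2) <= 1) ->
  let F j := X j i.+1 %% 2 != mu (8 * j + 2) in
  (forall j, j < m -> ~~ F j -> mu' (8 * j + 2) = mu (8 * j + 2)) ->
  (forall v, 2 * (\sum_(j < m) F j * incidence Z v j * mu' (8 * j + 2))
     <= \sum_(j < m) F j * incidence Z v j + 1) ->
  \sum_(j < m) F j <= 2 * (\sum_(j < m) F j * mu' (8 * j + 2)) ->
  feasible i.+1 mu ->
  feasible i mu' /\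
  \sum_(j < m) value i.+1 mu j <= 2 * \sum_(j < m) value i mu' j.
Proof.
move=> bX bits F same bal up feas.
(* With [X j i.+1 = 2 * X j i + D], the old value is [2 * X j i + D + c] for the carry [c]. If
   [D = c], half of it is [X j i + c], so the carry stays. Otherwise [D + c = 1], and the new carry
   says whether the half is rounded up. *)
have key j : j < m -> 2 * value i mu' j + F j =
    value i.+1 mu j + 2 * (F j * mu' (8 * j + 2)).
  move=> jm; have := bX _ jm i; have := same _ jm; have := bits j.
  rewrite /value /F; case: eqP => E; rewrite ?mul0n ?mul1n /=.
    by move=> _ ->; lia.
  by move=> b _; lia.
split=> [v|].
  have K : 2 * (\sum_(j < m) incidence Z v j * value i mu' j) +
      \sum_(j < m) F j * incidence Z v j =
      \sum_(j < m) incidence Z v j * value i.+1 mu j +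
      2 * (\sum_(j < m) F j * incidence Z v j * mu' (8 * j + 2)).
    rewrite !big_distrr /= -!big_split /=; apply: eq_bigr => j _.
    by have := key _ (ltn_ord j); nia.
  by have := bal v; have := feas v; rewrite expnS; lia.
have K : 2 * (\sum_(j < m) value i mu' j) + \sum_(j < m) F j =
    \sum_(j < m) value i.+1 mu j + 2 * (\sum_(j < m) F j * mu' (8 * j + 2)).
  rewrite !big_distrr /= -!big_split /=; apply: eq_bigr => j _.
  exact: key.
by lia.
Qed.

Variables (w : nat) (inp : nat -> nat -> nat).
Hypothesis G : graph_input w inp m Z.
Variable side : nat -> bool.
Hypothesis sideP : forall j, j < m -> side (Z j 1) = ~~ side (Z j 0).
Hypothesis w_large : 8 <= w.
Hypothesis X_binary : forall j, j < m -> binary (X j).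
Hypothesis inp_X : forall j k, j < m -> inp (j + 2) (k + 2) = X j (w * k) %% 2 ^ w.

Notation wp := (wp w inp).

Lemma consts_but c r r' : 6 < c -> c < 14 ->
  (forall a, a < 20 -> a <> c -> r' a = r a) -> consts m r -> consts m r'.
Proof. by move=> c6 c14 A; rewrite /consts !A //; lia. Qed.

Lemma wp_precision_loop (ld : nat -> nat) lb q Q r mu :
  (forall j, j < m -> leading (X j) (ld j)) ->
  (forall j, j < m -> ld j <= lb) -> lb + 4 < 2 ^ w ->
  consts m r -> r 8 = 2 ^ w.-1 -> r 12 = 0 -> clean mu ->
  (forall t r' mu', t <= (11 * lb + 30) * m + 3 ->
    (forall a, a < 20 -> a <> 12 -> r' a = r a) -> r' 12 <= lb ->
    (forall j, j < m -> ld j <= r' 12) -> clean mu' ->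
    (forall j, j < m -> mu' (8 * j + 2) = 0) ->
    wp q (fun t' => Q (t + t')) r' mu') ->
  wp (for_loop 5 precision_edge ++ q) Q r mu.
Proof.
move=> lead ldb lbw C r8 r12 cl HQ; have [W M8 _ _] := G.
pose I j t r' mu' := [/\ j <= m, t <= (11 * lb + 27) * j,
    forall a, a < 20 -> a <> 12 -> r' a = r a, r' 12 <= lb & clean mu'] /\
  [/\ forall i, i < j -> ld i <= r' 12 & forall i, i < j -> mu' (8 * i + 2) = 0].
have CI j t r' mu' : I j t r' mu' -> consts m r'.
  by move=> [[_ _ A _ _] _]; exact: consts_but A C.
apply: (wp_for (I := I) (N := m) (B := (11 * lb + 27) * m)) => //; try lia.
- move=> j t r' mu' HI; have [[? _ _ _] [_ _ _ _ ?]] := CI _ _ _ _ HI.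
  by case: HI => [[jm tj _ _ _] _]; split=> //; apply: leq_trans tj _; rewrite leq_mul2l jm orbT.
- move=> j t r' mu' u v [[jm tj A ub cl'] K]; split=> //; split=> // a a20 a12.
  by rewrite -A //; frame.
- by split; split; rewrite ?muln0 ?r12.
- move=> j t r' mu' jm r20 HI; have C1 := CI _ _ _ _ HI.
  case: HI => [[_ tj A ub [nd bits]] [K1 K2]].
  have [[r1 r2 r3 r4] [r6 r14 r15 r16 r5]] := C1.
  apply: (@wp_op _ _ (8 * j)); first by word.
  apply: (@wp_op _ _ (8 * j + 2)); first by word.
  apply: (@wp_write _ _ (8 * j + 2) 0); [by lookup|by lookup|].
  apply: (@wp_op _ _ (j + 2)); first by word.
  apply: wp_const; first lia.
  set r0 := upd _ 23 2.
  have A0 : agree 21 r' r0 by move=> a a21; rewrite /r0; frame.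
  have A0' : agree 20 r' r0 by move=> a a20; apply: A0; lia.
  apply: (@wp_leading_bit w inp m w_large (X j) (ld j) (j + 2) 2) => //.
  + exact: X_binary.
  + exact: lead.
  + have := ldb _ jm; lia.
  + by move=> k; rewrite inp_X.
  + by rewrite A0 // A.
  move=> t1 r1' tb1 A1 r24.
  have r'12 : r1' 12 = r' 12 by rewrite A1 ?A0.
  apply: (@wp_op _ _ (r' 12 < ld j)); first by lookup.
  apply: (@wp_if _ _ (r' 12 < ld j)); first by lookup.
  have r115 : r1' 15 = 0 by rewrite A1 // A0.
  have bits' i : upd mu' (8 * j + 2) 0 (8 * i + 2) <= 1.
    by rewrite updE; case: eqP.
  have nd' : no_dangling (upd mu' (8 * j + 2) 0).
    by move=> v; rewrite upd_neq //; lia.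
  have K2' i : i < j.+1 -> upd mu' (8 * j + 2) 0 (8 * i + 2) = 0.
    rewrite ltnS leq_eqVlt => /orP [/eqP -> |ij]; first by rewrite upd_same.
    by rewrite upd_neq; [exact: K2|lia].
  have tb2 : t1 <= 11 * lb + 16 by have := ldb _ jm; lia.
  have tb3 : (11 * lb + 27) * j.+1 = (11 * lb + 27) * j + (11 * lb + 27) by lia.
  case: (ltnP (r' 12) (ld j)) => le /=.
    apply: (@wp_op _ _ (ld j)); first by lookup; rewrite /eval_binop modn_small; have := ldb _ jm; lia.
    apply: wp_nil; split; first by lookup; rewrite A1 ?A0.
    split; split=> //.
    * lia.
    * by move=> a a20 a12; rewrite upd_neq // upd_neq ?A1 ?A0 ?A //; lia.
    * by rewrite upd_same; exact: ldb.
    * move=> i; rewrite ltnS leq_eqVlt upd_same => /orP [/eqP -> //|/K1]; lia.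
  apply: wp_nil; split; first by lookup; rewrite A1 ?A0.
  split; split=> //.
  * lia.
  * by move=> a a20 a12; rewrite upd_neq ?A1 ?A0 ?A //; lia.
  * by rewrite upd_neq // r'12.
  * move=> i; rewrite ltnS leq_eqVlt upd_neq // r'12 => /orP [/eqP -> //|/K1]; lia.
- move=> t r' mu' [[_ tj A ub cl'] [K1 K2]].
  apply: wp_mono (HQ (t + 3 * m + 3) r' mu' _ A ub K1 cl' K2) => //; lia.
Qed.

Lemma wp_advance L q Q r mu : L + 3 < 2 ^ w -> consts m r -> r 8 = 2 ^ w.-1 ->
  r 12 = L -> r 9 = 0 -> r 10 = 1 ->
  (forall t r', t <= 7 * L + 3 ->
    (forall a, a < 20 -> a <> 9 -> a <> 10 -> r' a = r a) ->
    position w L (r' 9) (r' 10) ->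
    wp q (fun t' => Q (t + t')) r' mu) ->
  wp (for_loop 12 (next_bit 9 10) ++ q) Q r mu.
Proof.
move=> Lw C r8 r12 r9 r10 HQ; have W := word_gt w_large.
pose I j t r' mu' := [/\ j <= L, t <= 4 * j, mu' = mu,
    forall a, a < 20 -> a <> 9 -> a <> 10 -> r' a = r a & position w j (r' 9) (r' 10)].
apply: (wp_for (I := I) (N := L) (B := 4 * L)) => //; try lia.
- move=> j t r' mu' [jL tj _ A _]; have [[r1 _ _ _] _] := C.
  by rewrite !A //; split=> //; lia.
- move=> j t r' mu' u v [jL tj -> A pos]; split=> // a a20 a9 a10.
  by rewrite -A //; frame.
- split=> //; rewrite r9 r10; apply: position0; lia.
- move=> j t r' mu' jL r20 [_ tj -> A pos].
  have C1 : consts m r' by move: C; rewrite /consts !A.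
  have r'8 : r' 8 = 2 ^ w.-1 by rewrite A.
  apply: wp_mono (@wp_next_bit w inp m w_large 9 10 j r' mu _ _ _ _ _ C1 r'8 pos _) => //; last lia.
  move=> t' r2 mu2 [t4 -> pos2 A2]; split; first by rewrite A2.
  split=> //; first lia.
  by move=> a a20 a9 a10; rewrite A2 // A.
- move=> t r' mu' [_ tj -> A pos].
  apply: wp_mono (HQ (t + 3 * L + 3) r' _ A pos) => //; lia.
Qed.

Lemma wp_level_loop L q Q r mu : L + 4 < 2 ^ w -> consts m r ->
  r 8 = 2 ^ w.-1 -> r 11 = L -> position w L (r 9) (r 10) -> clean mu ->
  feasible L mu ->
  (forall t r' mu', t <= (163 * m + 21) * L + 1 ->
    (forall a, a < 20 -> a <> 9 -> a <> 10 -> a <> 11 -> r' a = r a) ->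
    clean mu' -> feasible 0 mu' ->
    \sum_(j < m) value L mu j <= 2 ^ L * \sum_(j < m) value 0 mu' j ->
    wp q (fun t' => Q (t + t')) r' mu') ->
  wp (While 11 (split_level ++ previous_bit ++ [:: Do (Op Defs.Sub 11 11 1)]) :: q)
    Q r mu.
Proof.
move=> Lw C r8 r11 pos0 cl0 feas0 HQ; have [W M8 _ _] := G.
pose J t r' mu' := [/\ r' 11 <= L, t <= (163 * m + 21) * (L - r' 11),
    forall a, a < 20 -> a <> 9 -> a <> 10 -> a <> 11 -> r' a = r a,
    position w (r' 11) (r' 9) (r' 10) & clean mu'] /\
  [/\ feasible (r' 11) mu' &
    \sum_(j < m) value L mu j <= 2 ^ (L - r' 11) * \sum_(j < m) value (r' 11) mu' j].
apply: (wp_while (I := J) (B := (163 * m + 21) * L)).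
- by split; split; rewrite ?r11 // ?subnn ?muln0 // expn0 mul1n.
- by move=> t r' mu' [[le tb _ _ _] _]; apply: leq_trans tb _; rewrite leq_mul2l; lia.
- move=> t r' mu' [[le tb A pos cl] [feas S]] r'11.
  have C1 : consts m r' by move: C; rewrite /consts !A.
  case Ei : (r' 11) r'11 => [//|i] _; rewrite Ei in le tb pos feas S.
  have r'8 : r' 8 = 2 ^ w.-1 by rewrite A.
  have kle := position_le pos.
  apply: (@wp_split_level w inp m Z G side sideP (fun j => X j i.+1 %% 2) (r' 9) (r' 10)) => //.
  + lia.
  + by move=> j jm; rewrite inp_X // (binary_bit (X_binary jm) pos).
  move=> t1 r1 mu1 tb1 A1 cl1 same bal up.
  have [feas1 S1] := level_step X_binary cl.2 same bal up feas.
  have C2 := agree_consts (leqnn 20) A1 C1.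
  have pos1 : position w i.+1 (r1 9) (r1 10) by rewrite !A1.
  apply: wp_cat; apply: wp_mono (@wp_previous_bit w inp m w_large i r1 mu1 C2 pos1 _) => //;
    last lia.
  move=> t2 r2 mu2 [t4 -> pos2 A2].
  have r211 : r2 11 = i.+1 by rewrite A2 // A1.
  have r21 : r2 1 = 1 by have [[r1_1 _ _ _] _] := C2; rewrite A2.
  apply: (@wp_op _ _ i).
    lookup; have -> : i.+1 + 2 ^ w - 1 = i + 2 ^ w by lia.
    by rewrite modnDr modn_small //; lia.
  apply: wp_nil; rewrite /J upd_same; split; split=> //.
  + lia.
  + have -> : L - i = (L - i.+1).+1 by lia.
    by rewrite mulnS; lia.
  + by move=> a a20 a9 a10 a11; rewrite upd_neq // A2 // A1 // A.
  + have -> : L - i = (L - i.+1).+1 by lia.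
    apply: leq_trans S _; rewrite expnSr -mulnA leq_mul2l S1 orbT //.
- move=> t r' mu' [[le tb A pos cl] [feas S]] r'11.
  rewrite r'11 subn0 in tb feas S.
  apply: wp_mono (HQ t.+1 r' mu' _ A cl feas S) => //; lia.
Qed.

Lemma wp_round_all (E : nat -> nat) le (ld : nat -> nat) lb q Q r mu :
  binary E -> leading E le -> (forall k, inp 1 k = E (w * k) %% 2 ^ w) ->
  (forall j, j < m -> leading (X j) (ld j)) ->
  (forall j, j < m -> ld j <= lb) -> le + lb + 5 < 2 ^ w ->
  (forall i v, \sum_(j < m) incidence Z v j * X j i <= 2 ^ i) ->
  consts m r -> r 8 = 2 ^ w.-1 -> r 12 = 0 -> clean mu ->
  (forall L t r' mu', t <= 210 * (m + 1) * (le + lb + 1) ->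
    (forall a, a < 7 -> r' a = r a) -> consts m r' -> r' 7 = m ->
    (forall j, j < m -> le + ld j <= L) ->
    clean mu' -> feasible 0 mu' ->
    \sum_(j < m) X j L <= 2 ^ L * \sum_(j < m) value 0 mu' j ->
    wp q (fun t' => Q (t + t')) r' mu') ->
  wp (round_all ++ q) Q r mu.
Proof.
move=> bE leadE inp_E leadX ldb lw loads C r8 r12 cl HQ; have [W M8 _ _] := G.
rewrite /round_all -!catA.
have [[r1 r2 r3 r4] [r6 r14 r15 r16 r5]] := C.
apply: wp_const; first lia.
apply: wp_const; first lia.
set r0 := upd _ 23 0.
have A0 : agree 20 r r0 by move=> a a20; rewrite /r0; frame.
apply: (@wp_leading_bit w inp m w_large E le 1 0) => //.
- lia.
- by move=> k; rewrite addn0.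
move=> t1 r1' tb1 A1 r24.
have C1 : consts m r1'.
  by apply: (agree_consts (leqnn 20) _ C) => a a20; rewrite A1 ?A0 //; lia.
have [_ [_ _ r115 _ _]] := C1.
apply: (@wp_op _ _ le).
  by lookup; rewrite /eval_binop addn0 modn_small //; lia.
set r2' := upd r1' 18 le.
have A2 a : a < 20 -> a <> 18 -> r2' a = r a.
  by move=> a20 a18; rewrite /r2' upd_neq // A1 ?A0 //; lia.
have r218 : r2' 18 = le by rewrite /r2' upd_same.
have C2 : consts m r2' by move: C; rewrite /consts !A2.
clearbody r2'.
have r28 : r2' 8 = 2 ^ w.-1 by rewrite A2.
have r212 : r2' 12 = 0 by rewrite A2.
apply: (wp_precision_loop leadX ldb _ C2 r28 r212 cl); first lia.
move=> t3 r3' mu3 tb3 A3 ub3 K3 cl3 zero3.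
have C3 : consts m r3' by move: C2; rewrite /consts !A3.
have r318 : r3' 18 = le by rewrite A3.
have [[r31 _ _ _] _] := C3.
apply: (@wp_op _ _ (r3' 12 + le)); first by word.
apply: wp_const; first lia.
apply: wp_const; first lia.
set L := r3' 12 + le.
set r4' := upd _ 10 1.
have A4 a : a < 20 -> a <> 9 -> a <> 10 -> a <> 12 -> r4' a = r3' a.
  by move=> a20 a9 a10 a12; rewrite /r4'; frame.
have C4 : consts m r4' by move: C3; rewrite /consts !A4.
have r48 : r4' 8 = 2 ^ w.-1 by rewrite A4 // A3.
have r412 : r4' 12 = L by [].
have r49 : r4' 9 = 0 by [].
have r410 : r4' 10 = 1 by [].
clearbody r4'.
apply: (wp_advance _ C4 r48 r412 r49 r410); first by rewrite /L; lia.
move=> t5 r5' tb5 A5 pos5.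
have C5 : consts m r5' by move: C4; rewrite /consts !A5.
have [_ [_ _ r515 _ _]] := C5.
have r512 : r5' 12 = L by rewrite A5.
apply: (@wp_op _ _ L).
  by lookup; rewrite /eval_binop addn0 modn_small // /L; lia.
set r6' := upd r5' 11 L.
have A6 a : a <> 11 -> r6' a = r5' a by move=> a11; rewrite /r6' upd_neq.
have C6 : consts m r6' by move: C5; rewrite /consts !A6.
have r68 : r6' 8 = 2 ^ w.-1 by rewrite A6 // A5.
have r611 : r6' 11 = L by [].
have pos6 : position w L (r6' 9) (r6' 10) by rewrite !A6.
clearbody r6'.
(* All carries are 0 at the start, so the initial values are the plain truncations, which satisfy
   the load bounds. *)
have valL j : j < m -> value L mu3 j = X j L by move=> jm; rewrite /value zero3 // addn0.
apply: (wp_level_loop _ C6 r68 r611 pos6 cl3).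
- by rewrite /L; lia.
- move=> v; rewrite (eq_bigr (fun j : 'I_m => incidence Z v j * X j L)) //.
  by move=> j _; rewrite valL.
move=> t7 r7 mu7 tb7 A7 cl7 feas7 S7.
have C7 : consts m r7 by move: C6; rewrite /consts !A7.
have [_ [_ _ r715 _ r75]] := C7.
apply: (@wp_op _ _ m).
  by lookup; rewrite /eval_binop addn0 modn_small //; lia.
pose T0 := t1 + t3 + t5 + t7 + 8.
apply: wp_mono (HQ L T0 _ mu7 _ _ _ _ _ cl7 feas7 _) => //.
- move=> t' r' mu'; congr Q; rewrite /T0; lia.
- have Lb : L <= le + lb by rewrite /L; lia.
  have e1 : (163 * m + 21) * L <= (163 * m + 21) * (le + lb) by rewrite leq_mul2l Lb orbT.
  by rewrite /T0; nia.
- move=> a a7; rewrite upd_neq; last lia.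
  by rewrite A7 ?A6 ?A5 ?A4 ?A3 ?A2 //; lia.
- by move=> j jm; rewrite /L; have := K3 _ jm; lia.
- by rewrite -(eq_bigr _ (fun (j : 'I_m) _ => valL j (ltn_ord j))).
Qed.

End Levels.

(** * The whole program *)

Section Whole.
Variables (m : nat) (Z : nat -> nat -> nat) (X : nat -> nat -> nat).
Variables (w : nat) (inp : nat -> nat -> nat).
Hypothesis G : graph_input w inp m Z.
Hypothesis w_large : 8 <= w.
Hypothesis inp_X : forall j k, j < m -> inp (j + 2) (k + 2) = X j (w * k) %% 2 ^ w.
Hypothesis X0_le1 : forall j, j < m -> X j 0 <= 1.

Notation wp := (wp w inp).

Definition shortcut_size d :=
  minn ((2 ^ w - 1 - d) %/ ((2 ^ w - 1) %/ m)).+1 m.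

Lemma wp_setup q Q r : inp 0 1 = m -> inp 1 1 < 2 ^ w -> (forall a, r a = 0) ->
  (forall r', consts m r' -> r' 8 = 2 ^ w.-1 -> r' 12 = 0 -> r' 13 = 0 ->
    r' 0 = 0 -> r' 7 = shortcut_size (inp 1 1) ->
    forall t, t <= 20 -> wp q (fun t' => Q (t + t')) r' (fun=> 0)) ->
  wp (setup ++ q) Q r (fun=> 0).
Proof.
move=> inp_m; set d := inp 1 1 => dw r0 HQ; have [W M8 _ _] := G.
have Ew : 2 * 2 ^ w.-1 = 2 ^ w by rewrite -expnS prednK //; lia.
do 7! (apply: wp_const; first lia).
apply: (@wp_op _ _ (2 ^ w - 1)).
  lookup; rewrite r0 /eval_binop add0n modn_small //; lia.
apply: (@wp_op _ _ ((2 ^ w - 1) %/ 2)); first by lookup.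
apply: (@wp_op _ _ (2 ^ w.-1)).
  by lookup; rewrite /eval_binop modn_small; lia.
apply: (@wp_input _ _ m); first by lookup; rewrite r0.
apply: (@wp_input _ _ d); first by lookup.
set q0 := (2 ^ w - 1) %/ m.
apply: (@wp_op _ _ q0); first by lookup.
apply: (@wp_op _ _ (2 ^ w - 1 - d)).
  lookup; have -> : 2 ^ w - 1 + 2 ^ w - d = 2 ^ w - 1 - d + 2 ^ w by lia.
  by rewrite modnDr modn_small //; lia.
apply: (@wp_op _ _ ((2 ^ w - 1 - d) %/ q0)); first by lookup.
have small : ((2 ^ w - 1 - d) %/ q0).+1 < 2 ^ w.
  (* For [m = 0] both quotients are 0, division by zero being 0. *)
  case: (posnP m) => [m0|m0].
    by rewrite /q0 m0 divn0 divn0; lia.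
  have q8 : 2 <= q0 by rewrite /q0 leq_divRL //; lia.
  have : (2 ^ w - 1 - d) %/ q0 <= (2 ^ w - 1 - d) %/ 2 by rewrite leq_div2l.
  by lia.
apply: (@wp_op _ _ ((2 ^ w - 1 - d) %/ q0).+1).
  by lookup; rewrite /eval_binop addn1 modn_small.
apply: (@wp_op _ _ (m < ((2 ^ w - 1 - d) %/ q0).+1)); first by lookup.
apply: (@wp_if _ _ (m < ((2 ^ w - 1 - d) %/ q0).+1)); first by lookup.
case: (ltnP m) => mk /=.
  apply: (@wp_op _ _ m).
    by lookup; rewrite r0 /eval_binop addn0 modn_small //; lia.
  apply: (HQ _ _ _ _ _ _ _ 19) => //; try by lookup.
  - by lookup; rewrite /consts /= r0.
  - by lookup; rewrite /shortcut_size (minn_idPr _) // ltnW.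
apply: (HQ _ _ _ _ _ _ _ 18) => //; try by lookup.
- by lookup; rewrite /consts /= r0.
- by lookup; rewrite /shortcut_size (minn_idPl _).
Qed.

(** The comparison with 1/2 as the machine performs it, on the integer digit and the first
    fractional digit alone; a weight slightly above 1/2 may fail the test. *)
Definition heavy j := X j 0 + (2 ^ w.-1 < X j w %% 2 ^ w) != 0.

Lemma wp_shortcut K q Q r mu : K <= m -> consts m r -> r 8 = 2 ^ w.-1 ->
  r 7 = K -> r 13 = 0 -> clean mu ->
  (forall t r' mu', t <= 12 * K + 12 ->
    (forall a, a < 20 -> a <> 13 -> r' a = r a) -> clean mu' ->
    [/\ r' 13 = 0, forall j, j < K -> heavy j & forall j, j < K -> mu' (8 * j + 2) = 1]
    \/ (r' 13 = 1 /\ exists2 j, j < K & ~~ heavy j) ->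
    wp q (fun t' => Q (t + t')) r' mu') ->
  wp (shortcut ++ q) Q r mu.
Proof.
move=> Km C r8 r7 r13 cl HQ; have [W M8 _ _] := G.
have C1 := C; have [[r1 r2 r3 r4] [r6 r14 r15 r16 r5]] := C1.
apply: wp_const; first lia.
apply: (@wp_op _ _ (0 < K)); first by lookup.
pose J t r' mu' := [/\ r' 20 <= K, forall a, a < 20 -> a <> 13 -> r' a = r a, clean mu',
   forall j, j < r' 20 -> heavy j & forall j, j < r' 20 -> mu' (8 * j + 2) = 1] /\
  ([/\ t <= 12 * r' 20, r' 13 = 0 & r' 21 = (r' 20 < K)] \/
   [/\ t <= 12 * K + 9, r' 13 = 1, r' 21 = 0 & exists2 j, j < K & ~~ heavy j]).
apply: (wp_while (I := J) (B := 12 * K + 9)).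
- split; first by split=> // a a20 a13; frame.
  by left.
- move=> t r' mu' [[le _ _ _ _] [[tb _ _]|[tb _ _ _]]] //; lia.
- move=> t r' mu' [[le A [nd bits] hv mem1] [[tb r'13 r'21]|[_ _ -> //]]].
  rewrite r'21; case: ltnP => // jK _.
  have [j Ej] : exists j, r' 20 = j by exists (r' 20).
  rewrite Ej in le hv mem1 tb jK *.
  have jm : j < m by lia.
  have C' : consts m r' by move: C; rewrite /consts !A.
  have [[r'1 r'2 r'3 r'4] [r'6 r'14 r'15 r'16 r'5]] := C'.
  have r'8 : r' 8 = 2 ^ w.-1 by rewrite A.
  have r'7 : r' 7 = K by rewrite A.
  have i0 : inp (j + 2) 2 = X j 0.
    by rewrite (inp_X 0 jm) muln0 modn_small //; have := X0_le1 jm; lia.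
  have i1 : inp (j + 2) 3 = X j w %% 2 ^ w by rewrite (inp_X 1 jm) muln1.
  apply: (@wp_op _ _ (j + 2)); first by word.
  apply: (@wp_input _ _ (X j 0)); first by lookup.
  apply: (@wp_input _ _ (X j w %% 2 ^ w)); first by lookup.
  apply: (@wp_op _ _ (2 ^ w.-1 < X j w %% 2 ^ w)); first by lookup.
  apply: (@wp_op _ _ (X j 0 + (2 ^ w.-1 < X j w %% 2 ^ w))).
    lookup; rewrite /eval_binop modn_small //; have := X0_le1 jm.
    by case: (_ < _ %% _); lia.
  apply: (@wp_if _ _ (X j 0 + (2 ^ w.-1 < X j w %% 2 ^ w))); first by lookup.
  rewrite -/(heavy j); case hj: (heavy j) => /=.
    apply: (@wp_op _ _ (8 * j)); first by word.
    apply: (@wp_op _ _ (8 * j + 2)); first by word.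
    apply: (@wp_write _ _ (8 * j + 2) 1); [by lookup|by lookup|].
    apply: (@wp_op _ _ j.+1); first by word.
    apply: (@wp_op _ _ (j.+1 < K)); first by lookup.
    apply: wp_nil; rewrite /J; set r2' := upd _ 21 _.
    have E20 : r2' 20 = j.+1 by [].
    have E21 : r2' 21 = (j.+1 < K) by [].
    have E13 : r2' 13 = 0 by rewrite /r2'; lookup.
    have A2 a : a < 20 -> r2' a = r' a by move=> a20; rewrite /r2'; frame.
    clearbody r2'; rewrite E20; split; last by left; split=> //; lia.
    split=> //.
    + by move=> a a20 a13; rewrite A2 // A.
    + split=> [v|i]; first by rewrite upd_neq //; lia.
      by rewrite updE; case: eqP.
    + by move=> i; rewrite ltnS leq_eqVlt => /orP [/eqP ->|/hv].
    + move=> i; rewrite ltnS leq_eqVlt => /orP [/eqP ->|ij]; first by rewrite upd_same.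
      by rewrite upd_neq; [exact: mem1|lia].
  apply: wp_const; first lia.
  apply: wp_const; first lia.
  apply: wp_nil; rewrite /J; set r2' := upd _ 21 _.
  have E20 : r2' 20 = j by rewrite /r2'; lookup.
  have A2 a : a < 20 -> a <> 13 -> r2' a = r' a by move=> a20 a13; rewrite /r2'; frame.
  rewrite E20; split; last first.
    by right; split=> //; [lia | exists j => //; rewrite hj].
  split=> //.
  by move=> a a20 a13; rewrite A2 // A.
- move=> t r' mu' [[le A cl' hv mem1] H2] r'21.
  apply: wp_mono (HQ (t + 3) r' mu' _ A cl' _).
  + by move=> t' r2' mu2; congr Q; lia.
  + by case: H2 => [[tb _ _]|[tb _ _ _]]; lia.
  + case: H2 => [[tb r'13 E]|[tb r'13 _ ex]]; last by right.
    left; have EK : r' 20 = K by move: E; rewrite r'21; case: ltnP => //; lia.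
    by rewrite EK in hv mem1.
Qed.

Definition selected (b : nat -> nat) K := [seq j <- iota 0 K | X j 0 + b j != 0].

Lemma selectedS b K : selected b K.+1 =
  if X K 0 + b K != 0 then rcons (selected b K) K else selected b K.
Proof.
rewrite /selected -addn1 iotaD filter_cat /= add0n.
by case: ifP => _; rewrite ?cats1 ?cats0.
Qed.

Lemma size_selected b K : size (selected b K) <= K.
Proof. by rewrite size_filter -[X in _ <= X](size_iota 0) count_size. Qed.

Definition listed js mu := forall c, c < size js ->
  mu (2 * c) = Z (nth 0 js c) 0 /\ mu (2 * c + 1) = Z (nth 0 js c) 1.

(** The output overwrites the working memory from address 0. After [j] edges at most [j] have been
    selected, so the writes stay below the carries still to be read. *)
Lemma wp_output K Q r mu : K <= m -> consts m r -> r 7 = K -> r 0 = 0 -> clean mu ->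
  (forall t r' mu', t <= 20 * K + 3 ->
    let js := selected (fun j => mu (8 * j + 2)) K in
    r' 0 = size js -> listed js mu' -> Q t r' mu') ->
  wp (for_loop 7 output_edge) Q r mu.
Proof.
move=> Km C r7 r0 [nd bits] HQ; have [W M8 _ _] := G.
rewrite -[for_loop _ _]cats0.
pose sel := selected (fun j => mu (8 * j + 2)).
pose I j t r' mu' := [/\ j <= K, t <= 17 * j,
    forall a, 0 < a -> a < 20 -> r' a = r a & r' 0 = size (sel j)] /\
  (listed (sel j) mu' /\ forall i, j <= i -> mu' (8 * i + 2) = mu (8 * i + 2)).
apply: (wp_for (I := I) (N := K) (B := 17 * K)) => //; try lia.
- move=> j t r' mu' [[jK tj A _] _]; have [[r1 _ _ _] _] := C.
  by rewrite !A //; split=> //; lia.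
- move=> j t r' mu' u v [[jK tj A E0] H]; split=> //; split=> // a a0 a20.
  by rewrite -A //; frame.
- move=> j t r' mu' jK r20 [[_ tj A E0] [Ls same]].
  have jm : j < m by lia.
  have C' : consts m r' by move: C; rewrite /consts !A.
  have [[r'1 r'2 r'3 r'4] [r'6 r'14 r'15 r'16 r'5]] := C'.
  have i0 : inp (j + 2) 2 = X j 0.
    by rewrite (inp_X 0 jm) muln0 modn_small //; have := X0_le1 jm; lia.
  have Z0 := input_vertex G jm (isT : 0 < 2).
  have Z1 := input_vertex G jm (isT : 1 < 2).
  set b := mu (8 * j + 2).
  have b1 : b <= 1 by exact: bits.
  apply: (@wp_op _ _ (j + 2)); first by word.
  apply: (@wp_input _ _ (X j 0)); first by lookup.
  apply: (@wp_op _ _ (8 * j)); first by word.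
  apply: (@wp_op _ _ (8 * j + 2)); first by word.
  apply: (@wp_read _ _ b); first by lookup; exact: same.
  apply: (@wp_op _ _ (X j 0 + b)).
    by lookup; rewrite /eval_binop modn_small //; have := X0_le1 jm; lia.
  apply: (@wp_if _ _ (X j 0 + b)); first by lookup.
  have cj : size (sel j) <= j := size_selected _ _.
  have selS : sel j.+1 = if X j 0 + b != 0 then rcons (sel j) j else sel j by exact: selectedS.
  case: ifP selS => s selS.
    apply: (@wp_input _ _ (Z j 0)); first by lookup.
    apply: (@wp_input _ _ (Z j 1)); first by lookup.
    apply: (@wp_op _ _ (2 * size (sel j))).
      by lookup; rewrite /eval_binop modn_small; lia.
    apply: (@wp_write _ _ (2 * size (sel j)) (Z j 0)); [by lookup|by lookup|].
    apply: (@wp_op _ _ (2 * size (sel j) + 1)).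
      by lookup; rewrite /eval_binop modn_small; lia.
    apply: (@wp_write _ _ (2 * size (sel j) + 1) (Z j 1)); [by lookup|by lookup|].
    apply: (@wp_op _ _ (size (sel j)).+1).
      by lookup; rewrite /eval_binop addn1 modn_small; lia.
    apply: wp_nil; split; first by lookup.
    split.
      split=> //; first lia.
      + move=> a a0 a20; rewrite upd_neq; last lia.
        by rewrite -A //; frame.
      + by rewrite selS size_rcons upd_same.
    split.
      rewrite selS => c; rewrite size_rcons ltnS nth_rcons leq_eqVlt.
      case/orP => [/eqP ->|cl].
        rewrite ltnn eqxx upd_same; split=> //.
        by rewrite upd_neq ?upd_same //; lia.
      have [L0 L1] := Ls _ cl.
      by rewrite cl; split; rewrite !upd_neq ?L0 ?L1 //; lia.
    by move=> i ji; rewrite !upd_neq ?same //; lia.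
  apply: wp_nil; split; first by lookup.
  split.
    split=> //; [lia| |by rewrite selS; lookup].
    by move=> a a0 a20; rewrite -A //; frame.
  by rewrite selS; split=> // i ji; apply: same; lia.
- move=> t r' mu' [[_ tj A E0] [Ls same]].
  by apply: wp_nil; apply: HQ => //; lia.
Qed.

Variable side : nat -> bool.
Hypothesis sideP : forall j, j < m -> side (Z j 1) = ~~ side (Z j 0).
Hypothesis X_binary : forall j, j < m -> binary (X j).

(** The two alternatives are the successful shortcut and the full rounding. In both, [b] is the
    final carry and the output consists of the edges with [X j 0 + b j] nonzero. *)
Lemma wp_rounding (E : nat -> nat) le (ld : nat -> nat) lb r :
  inp 0 1 = m -> (forall a, r a = 0) ->
  binary E -> leading E le -> (forall k, inp 1 k = E (w * k) %% 2 ^ w) ->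
  (forall j, j < m -> leading (X j) (ld j)) ->
  (forall j, j < m -> ld j <= lb) -> le + lb + 5 < 2 ^ w ->
  (forall i v, \sum_(j < m) incidence Z v j * X j i <= 2 ^ i) ->
  let K := shortcut_size (inp 1 1) in
  wp rounding (fun t r' mu' => exists K' b, let js := selected b K' in
    [/\ K' <= m, r' 0 = size js, listed js mu' &
     [/\ K' = K, forall j, j < K -> heavy j, forall j, j < K -> b j = 1 &
         t <= 40 * (K + 1)] \/
     [/\ K' = m, exists2 j, j < m & ~~ heavy j,
       forall v, \sum_(j < m) incidence Z v j * (X j 0 + b j) <= 1,
       exists L, (forall j, j < m -> le + ld j <= L) /\
         \sum_(j < m) X j L <= 2 ^ L * \sum_(j < m) (X j 0 + b j) &
       t <= 300 * (m + 1) * (le + lb + 1)]]) r (fun=> 0).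
Proof.
move=> inp_m r0 bE leadE inp_E leadX ldb lw loads K; have [W M8 _ _] := G.
have Km : K <= m by rewrite /K /shortcut_size geq_minr.
rewrite /rounding; apply: wp_setup => //; first by rewrite inp_E ltn_mod expn_gt0.
move=> r1' C1 r18 r112 r113 r10 r17 t1 tb1.
apply: (wp_shortcut Km C1 r18 r17 r113) => // t2 r2' mu2 tb2 A2 cl2.
have C2 : consts m r2' by move: C1; rewrite /consts !A2.
case=> [[r213 hv mem1]|[r213 [j jK nh]]].
  apply: (@wp_if _ _ 0) => //=.
  apply: (@wp_output K) => //; rewrite ?A2 //.
  move=> t3 r3' mu3 tb3 js r30 Ls.
  exists K, (fun j => mu2 (8 * j + 2)); split=> //; left; split=> //; lia.
apply: (@wp_if _ _ 1) => //; rewrite [_ != 0]/=.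
apply: (@wp_round_all m Z X w inp G side sideP w_large X_binary inp_X E le ld lb) => //.
- by rewrite A2.
- by rewrite A2.
move=> L t3 r3' mu3 tb3 A3 C3 r37 bl cl3 feas S.
apply: (@wp_output m) => //; first by rewrite A3 // A2.
move=> t4 r4' mu4 tb4 js r40 Ls.
exists m, (fun j => mu3 (8 * j + 2)); split=> //; right; split=> //.
- by exists j => //; lia.
- by exists L.
- nia.
Qed.

End Whole.

Local Open Scope ring_scope.

(** * Binary expansions of real numbers *)

Section Expansion.
Variable R : realType.
Implicit Types y : R.

Definition scaled y (i : nat) : nat := Num.truncn (y * 2%:R ^+ i).

Lemma scaledP y i : 0 <= y ->
  (scaled y i)%:R <= y * 2%:R ^+ i < (scaled y i).+1%:R.
Proof. by move=> y0; apply: truncn_itv; rewrite mulr_ge0 // exprn_ge0. Qed.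

Lemma binary_scaled y : 0 <= y -> binary (scaled y).
Proof.
move=> y0 i; have /andP [l1 u1] := scaledP i.+1 y0.
set t := scaled y i.+1 in l1 u1 *; symmetry; apply: truncn_def.
have h1 : ((t %/ 2)%:R : R) * 2%:R <= t%:R.
  by rewrite -natrM ler_nat leq_trunc_div.
have h2 : (t.+1%:R : R) <= (t %/ 2).+1%:R * 2%:R.
  by rewrite -natrM ler_nat ltn_ceil.
by rewrite exprSr mulrA in l1 u1; apply/andP; split; lra.
Qed.

Lemma digitE w y k : digit w y k = (scaled y (w * k) %% 2 ^ w)%N.
Proof. by []. Qed.

Lemma ln_le_sub1 y : 0 < y -> ln y <= y - 1.
Proof.
move=> y0; have := @le_ln1Dx R (y - 1).
have -> : 1 + (y - 1) = y by ring.
by apply; lra.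
Qed.

(** The inequality [ln y <= y - 1] at [y = 1/2]. *)
Lemma ln2_ge : 1 / 2%:R <= ln (2%:R : R).
Proof.
have := ln_le_sub1 (_ : 0 < (2%:R : R)^-1); rewrite lnV ?posrE ?invr_gt0 //.
by move=> h; have := h (ltr0n _ 2); lra.
Qed.

(* l is the least i with 1 <= y 2^i. *)
Lemma leading_scaled y : 0 < y <= 1 -> exists l, [/\ leading (scaled y) l,
  1 <= y * 2%:R ^+ l & l%:R <= 1 + 2%:R * ln (y^-1)].
Proof.
move=> /andP [y0 y1].
have ybin := binary_scaled (ltW y0).
have ex : exists i, scaled y i != 0%N.
  (* With [t] the integer part of [1/y], [2^(t+1) >= t + 1 > 1/y]. *)
  exists (scaled y^-1 0).+1; rewrite -lt0n truncn_gt0.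
  have yi : 0 <= y^-1 by rewrite invr_ge0 ltW.
  have /andP [_] := scaledP 0 yi; rewrite expr0 mulr1.
  set t := scaled _ _ => u.
  have t2 : (t.+1%:R : R) <= 2%:R ^+ t.+1 by rewrite -natrX ler_nat ltnW // ltn_expl.
  apply: (@le_trans _ _ (y * y^-1)); first by rewrite mulfV ?lt0r_neq0.
  rewrite ler_wpM2l ?(ltW y0) //.
  exact: le_trans (ltW u) t2.
case: (ex_minnP ex) => l l0 lmin.
have low i : (i < l)%N -> scaled y i = 0%N.
  by move=> il; apply/eqP; apply: contraTT il => /lmin; rewrite -leqNgt.
have l1 : scaled y l = 1%N.
  case: (l) l0 low => [|l'] l0 low.
    apply/eqP; rewrite eqn_leq lt0n l0 andbT truncn_le_nat expr0; lra.
  have := ybin l'; rewrite (low l') // => E.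
  by case: (scaled y l'.+1) l0 E => [|[|k]] // _ E; exfalso; lia.
exists l; split.
- by split=> [|i il]; [rewrite l1 | rewrite low].
- have /andP [+ _] := scaledP l (ltW y0); by rewrite l1.
- rewrite lnV ?posrE //; have := ln_le0 y1.
  case: (l) low => [|l'] low; first by lra.
  have /andP [_ +] := scaledP l' (ltW y0); rewrite (low l') // => u _.
  have p0 : 0 < (2%:R : R) ^+ l' by rewrite exprn_gt0.
  (* By minimality [y 2^l' < 1] for [l' = l - 1], so [l' ln 2] is below [ln (1/y)]; then
     [ln 2 >= 1/2]. *)
  have := ln_le_sub1 (mulr_gt0 y0 p0).
  rewrite lnM ?posrE // lnXn // -[ln _ *+ _]mulr_natr => h.
  have h2 := ln2_ge; have l'0 : 0 <= (l'%:R : R) by [].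
  have h3 : l'%:R * (1 / 2%:R) <= ln (2%:R : R) * l'%:R.
    by rewrite mulrC ler_wpM2r.
  rewrite -(natr1 l'); lra.
Qed.

End Expansion.

(** * Numerical guarantees of the shortcut *)

Section ShortcutBounds.
Variable R : realType.

Lemma shortcut_size_bounds w m (eps : R) : 0 < eps < 1 ->
  (8 * m + 8 <= 2 ^ w)%N ->
  let K := shortcut_size m w (digit w eps 1) in
  (1 - eps) * m%:R <= K%:R /\ K%:R <= 1 + 2%:R * m%:R * (1 - eps).
Proof.
move=> /andP [e0 e1] mw K.
case: (posnP m) => [m0|m0].
  by rewrite /K /shortcut_size m0 minn0 mulr0 /=; split; lra.
have W0 : (0 : R) < 2%:R ^+ w by rewrite exprn_gt0.
set d := digit w eps 1.
have Ed : d = scaled eps w.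
  rewrite /d digitE muln1 modn_small // truncn_lt_nat ?mulr_ge0 ?(ltW e0) ?(ltW W0) //.
  by rewrite natrX; nra.
have /andP [dl du] := scaledP w (ltW e0); rewrite -Ed in dl du.
have dW : (d < 2 ^ w)%N by rewrite ltn_mod expn_gt0.
pose W := (2 ^ w)%N; have EW : (W%:R : R) = 2%:R ^+ w by rewrite natrX.
rewrite -EW in dl du W0.
pose q := ((2 ^ w - 1) %/ m)%N.
pose k := ((2 ^ w - 1 - d) %/ q)%N.
have q0 : (0 < q)%N by rewrite /q divn_gt0 //; lia.
have qm : (q * m <= W - 1)%N by exact: leq_trunc_div.
have qm' : (W - 1 < q.+1 * m)%N by exact: ltn_ceil.
have kq : (k * q <= W - 1 - d)%N by exact: leq_trunc_div.
have kq' : (W - 1 - d < k.+1 * q)%N by exact: ltn_ceil.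
have EK : K = minn k.+1 m by [].
rewrite -/W in mw dW.
have Wd : ((W - d)%N%:R : R) = W%:R - d%:R by rewrite natrB // ltnW.
have m0' : 0 < (m%:R : R) by rewrite ltr0n.
split.
- rewrite EK /minn; case: ltnP => _; last by nra.
  (* [W - d <= (k + 1) q] and [q m <= W - 1]; moreover [d <= eps W]. *)
  have h : ((W - d) * m <= W * k.+1)%N by nia.
  move: h; rewrite -(ler_nat R) !natrM Wd => h.
  rewrite -(ler_pM2l W0); nra.
- have Kk : (K <= k.+1)%N by rewrite EK geq_minl.
  move: Kk; rewrite -(ler_nat R) -natr1 => Kk.
  suff : (k%:R : R) <= 2%:R * m%:R * (1 - eps) by lra.
  (* Rounding the quotient [q >= 1] down loses at most a factor 2, the source of the 2 in the upper
     bound. *)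
  have h1 : (W <= 2 * q * m)%N by nia.
  have h2 : (k * q + d.+1 <= W)%N by lia.
  have {}h1 : (W%:R : R) <= 2%:R * q%:R * m%:R by rewrite -!natrM ler_nat.
  have {}h2 : k%:R * q%:R + d.+1%:R <= (W%:R : R) by rewrite -natrM -natrD ler_nat.
  have q0' : 0 < (q%:R : R) by rewrite ltr0n.
  have h3 : k%:R * q%:R <= W%:R * (1 - eps) by lra.
  have h4 : W%:R * (1 - eps) <= 2%:R * q%:R * m%:R * (1 - eps).
    by rewrite ler_wpM2r //; lra.
  rewrite -(ler_pM2r q0'); lra.
Qed.

Lemma heavy_gt_half w (y : R) (X : nat -> nat -> nat) j :
  (0 < w)%N -> 0 <= y <= 1 ->
  (forall i, X j i = scaled y i) -> heavy X w j -> 1 / 2%:R < y.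
Proof.
move=> w0 /andP [y0 y1] XE; rewrite /heavy !XE.
have /andP [l0 _] := scaledP 0 y0; rewrite expr0 mulr1 in l0.
case: (posnP (scaled y 0)) => [->|s0 _]; last first.
  have s1 : (1 : R) <= (scaled y 0)%:R by rewrite ler1n.
  by lra.
rewrite add0n; case: ltnP => // h _.
have {}h : (2 ^ w.-1 < scaled y w)%N by apply: leq_trans h _; exact: leq_mod.
have /andP [lw _] := scaledP w y0.
have p0 : 0 < (2%:R : R) ^+ w.-1 by rewrite exprn_gt0.
move: h; rewrite -(ltr_nat R) natrX => h.
have Ew : (2%:R : R) ^+ w = 2%:R * 2%:R ^+ w.-1 by rewrite -exprS prednK.
rewrite Ew in lw; nra.
Qed.

(** Truncation after one digit leaves [y < 1/2 + 2^-w]. Any constant below 1 would serve: it only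
    has to keep [xmin], and with it the logarithm, away from trivial values. *)
Lemma not_heavy_le w (y : R) (X : nat -> nat -> nat) j :
  (8 <= w)%N -> 0 <= y <= 1 ->
  (forall i, X j i = scaled y i) -> ~~ heavy X w j -> y <= 3%:R / 4%:R.
Proof.
move=> w8 /andP [y0 y1] XE; rewrite /heavy !XE.
have /andP [_ u0] := scaledP 0 y0; rewrite expr0 mulr1 in u0.
rewrite negbK addn_eq0 => /andP [/eqP s0]; rewrite s0 in u0.
rewrite eqb0 -leqNgt.
have p0 : 0 < (2%:R : R) ^+ w.-1 by rewrite exprn_gt0.
have Ew : (2%:R : R) ^+ w = 2%:R * 2%:R ^+ w.-1 by rewrite -exprS prednK //; lia.
have /andP [lw uw] := scaledP w y0.
have sw : (scaled y w < 2 ^ w)%N by rewrite -(ltr_nat R) natrX; nra.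
rewrite modn_small // => h.
have h' : ((scaled y w).+1%:R : R) <= (2 ^ w.-1).+1%:R by rewrite ler_nat ltnS.
rewrite -[X in _ <= X]natr1 natrX in h'.
have p4 : (4 <= 2 ^ w.-1)%N.
  by apply: leq_trans (_ : 2 ^ 2 <= _)%N => //; rewrite leq_exp2l //; lia.
move: p4; rewrite -(ler_nat R) natrX => p4.
rewrite Ew in uw; nra.
Qed.

End ShortcutBounds.

(** * Edge lists *)

Section EdgeLists.
Variables (R : realType) (n : nat).
Implicit Types (E S M : {set {set 'I_n}}) (x : {set 'I_n} -> R).
Implicit Types es ms : seq ('I_n * 'I_n).

Definition edge (p : 'I_n * 'I_n) : {set 'I_n} := [set p.1; p.2].

Definition endpoint es j s : nat :=
  if onth es j is Some p then (if s == 0%N then p.1 else p.2) else 0%N.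

Lemma onth_lt p0 es j : (j < size es)%N -> onth es j = Some (nth p0 es j).
Proof.
by move=> jm; have := onthTE es j; rewrite jm -odflt_onth; case: (onth es j).
Qed.

Lemma endpointE p0 es j : (j < size es)%N ->
  (endpoint es j 0 = (nth p0 es j).1 :> nat) *
  (endpoint es j 1 = (nth p0 es j).2 :> nat).
Proof. by move=> jm; rewrite /endpoint !(onth_lt p0). Qed.

Variables (E : {set {set 'I_n}}) (x : {set 'I_n} -> R) (p0 : 'I_n * 'I_n).
Variable es : seq ('I_n * 'I_n).
Hypothesis simpleE : simple_graph E.
Hypothesis bipE : bipartite E.
Hypothesis fmE : fractional_matching E x.
Hypothesis esE : edge_list (supp E x) es.

Notation m := (size es).
Notation Z := (endpoint es).
Notation nedge j := (edge (nth p0 es j)).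

Lemma sum_edges (V : nmodType) (g : {set 'I_n} -> V) :
  \sum_(e in supp E x) g e = \sum_(j < m) g (nedge j).
Proof.
have [u mem] := esE.
rewrite -(eq_bigl _ _ mem) -big_uniq // big_map (big_nth p0) big_mkord.
exact: eq_bigr.
Qed.

Lemma nedge_supp j : (j < m)%N -> nedge j \in supp E x.
Proof.
by move=> jm; have [_ <-] := esE; apply: map_f; exact: mem_nth.
Qed.

Lemma nedge_inj i j : (i < m)%N -> (j < m)%N -> nedge i = nedge j -> i = j.
Proof.
move=> im jm; have [u _] := esE => H.
apply/eqP; rewrite -(nth_uniq set0 _ _ u) ?size_map //.
by rewrite !(nth_map p0) //; apply/eqP.
Qed.

Lemma weight_bounds j : (j < m)%N -> 0 < x (nedge j) <= 1.
Proof.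
move=> jm; have := nedge_supp jm; rewrite inE => /andP [jE ->] /=.
have [x0 load] := fmE; apply: le_trans (load (nth p0 es j).1).
rewrite /vertex_load (bigD1 (nedge j)) /=; last by rewrite jE !inE eqxx.
by rewrite lerDl sumr_ge0 // => e /andP [/andP [eE _] _]; exact: x0.
Qed.

Lemma endpoints_neq j : (j < m)%N -> (nth p0 es j).1 != (nth p0 es j).2.
Proof.
move=> jm; have := nedge_supp jm; rewrite inE => /andP [/simpleE].
by rewrite cards2; case: (_ != _).
Qed.

Lemma incidenceE (v : 'I_n) j : (j < m)%N -> incidence Z v j = (v \in nedge j).
Proof.
move=> jm; have ne := endpoints_neq jm; rewrite /incidence !(endpointE p0) // !inE.
rewrite !val_eqE ![_ == v]eq_sym.
by case: eqP => [->|_]; [rewrite (negPf ne)|case: eqP].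
Qed.

Lemma incidence_out v j : (j < m)%N -> (n <= v)%N -> incidence Z v j = 0%N.
Proof.
move=> jm nv; rewrite /incidence !(endpointE p0) //.
have := ltn_ord (nth p0 es j).1; have := ltn_ord (nth p0 es j).2.
by case: eqP => [->|_]; case: eqP => [->|_] //; lia.
Qed.

Lemma weighted_load (v : 'I_n) :
  \sum_(j < m) (incidence Z v j)%:R * x (nedge j) <= 1.
Proof.
have [x0 load] := fmE; apply: le_trans (load v).
rewrite (eq_bigr (fun j : 'I_m => (v \in nedge j)%:R * x (nedge j))); last first.
  by move=> j _; rewrite incidenceE.
rewrite -(sum_edges (fun e => (v \in e)%:R * x e)) /vertex_load.
rewrite big_mkcond [X in _ <= X]big_mkcond /=; apply: ler_sum => e _.
rewrite inE; case eE: (e \in E) => //=.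
by have := x0 _ eE; case: (0 < x e); case: (v \in e); rewrite ?mul1r ?mul0r.
Qed.

Lemma scaled_load i v :
  (\sum_(j < m) incidence Z v j * scaled (x (nedge j)) i <= 2 ^ i)%N.
Proof.
case: (ltnP v n) => [vn|nv]; last by rewrite big1 // => j _; rewrite incidence_out.
rewrite -(ler_nat R) natr_sum natrX.
have p0' : 0 < (2%:R : R) ^+ i by rewrite exprn_gt0.
apply: le_trans (_ : (\sum_(j < m) (incidence Z v j)%:R * x (nedge j)) * 2%:R ^+ i <= _).
  rewrite mulr_suml; apply: ler_sum => j _; rewrite natrM -mulrA ler_wpM2l //.
  have /andP [xj _] := weight_bounds (ltn_ord j).
  by have /andP [] := scaledP i (ltW xj).
by have := weighted_load (Ordinal vn); nra.
Qed.

Lemma side_exists : exists side : nat -> bool,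
  forall j, (j < m)%N -> side (Z j 1) = ~~ side (Z j 0).
Proof.
have [A HA] := bipE; exists (fun k => [exists v : 'I_n, (val v == k) && (v \in A)]).
have S (v : 'I_n) : [exists u : 'I_n, (val u == val v) && (u \in A)] = (v \in A).
  apply/existsP/idP => [[u /andP [/eqP /val_inj -> //]]|vA].
  by exists v; rewrite eqxx.
move=> j jm; rewrite !(endpointE p0) // !S.
have ne := endpoints_neq jm.
have := nedge_supp jm; rewrite inE => /andP [/HA [a [b [aA bA E1]]] _].
have K v : v \in nedge j -> (v == a) || (v == b) by rewrite E1 !inE.
have := K (nth p0 es j).1; have := K (nth p0 es j).2.
rewrite !inE !eqxx orbT => /(_ isT) + /(_ isT).
by move=> /orP [] /eqP E2 /orP [] /eqP E3; move: ne; rewrite E2 E3 ?eqxx // (negPf bA) aA.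
Qed.

Lemma size_edges : (m <= n * n)%N.
Proof.
have [/map_uniq u _] := esE.
by rewrite -(card_uniqP u) -[in (n * n)%N](card_ord n) -card_prod max_card.
Qed.

Lemma xmin_le e : e \in supp E x -> xmin E x <= x e.
Proof.
by move=> eS; rewrite /xmin (bigD1 e) //= ge_min lexx.
Qed.

Lemma xmin_bounds : 0 < xmin E x <= 1.
Proof.
rewrite /xmin; apply: (big_ind (fun y : R => 0 < y <= 1)).
- by rewrite ltr01 lexx.
- by move=> a b /andP [a0 a1] /andP [b0 b1]; rewrite lt_min a0 b0 ge_min a1.
move=> e eS; have [_ mem] := esE; move: eS; rewrite -mem => /mapP [p pe ->].
have := weight_bounds (j := index p es); rewrite index_mem => /(_ pe).
by rewrite nth_index.
Qed.

(** Two selected edges with a common vertex would load it by more than 1. The shortcut uses this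
    with [g] the weights themselves, the full rounding with [g] the final integral values. *)
Lemma selected_matching (js : seq nat) (g : nat -> R) r mu :
  uniq js -> (forall j, j \in js -> (j < m)%N) ->
  (forall j, (j < m)%N -> 0 <= g j) ->
  (forall j, j \in js -> 1 / 2%:R < g j) ->
  (forall v : 'I_n, \sum_(j < m) (incidence Z v j)%:R * g j <= 1) ->
  r 0%N = size js -> listed Z js mu ->
  exists M, [/\ outputs (State r mu) M, integral_matching E M /\ M \subset supp E x &
    #|M| = size js].
Proof.
move=> ujs jsm g0 gh load r0 Ls.
pose ms := [seq nth p0 es j | j <- js].
have ems : [seq edge p | p <- ms] = [seq nedge j | j <- js] by rewrite -map_comp.
have ums : uniq [seq edge p | p <- ms].
  rewrite ems map_inj_in_uniq // => i j /jsm im /jsm jm; exact: nedge_inj.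
pose M : {set {set 'I_n}} := [set e in [seq edge p | p <- ms]].
have MS : M \subset supp E x.
  apply/subsetP => e; rewrite inE ems => /mapP [j /jsm jm ->]; exact: nedge_supp.
exists M; split.
- exists ms; split.
  + by split=> // e; rewrite inE.
  + by rewrite size_map.
  + move=> c u v; case: (ltnP c (size js)) => cs; last first.
      by rewrite onth_default // size_map.
    rewrite (onth_lt p0) ?size_map // (nth_map 0%N) //.
    have jm := jsm _ (mem_nth 0%N cs).
    case=> E1; have [L0 L1] := Ls _ cs.
    rewrite !(endpointE p0) // E1 in L0 L1.
    by rewrite -addn1 -mul2n; split.
- split=> //; split.
    by apply: subset_trans MS _; apply/subsetP => e; rewrite inE => /andP [].
  apply/trivIsetP => e1 e2; rewrite !inE ems => /mapP [i ijs ->] /mapP [j jjs ->] ne.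
  rewrite disjoint_subset; apply/subsetP => v vi; rewrite inE; apply/negP => vj.
  have im := jsm _ ijs; have jm := jsm _ jjs.
  have := load v; rewrite (bigD1 (Ordinal im)) //= (bigD1 (Ordinal jm)) /=; last first.
    by apply/eqP => /(congr1 val) /= E1; move: ne; rewrite E1 eqxx.
  have rest : 0 <= \sum_(k < m | (k != Ordinal im) && (k != Ordinal jm))
      (incidence Z v k)%:R * g k.
    by apply: sumr_ge0 => k _; rewrite mulr_ge0 // g0.
  rewrite !incidenceE // vi vj !mul1r; have := gh _ ijs; have := gh _ jjs; lra.
- by rewrite /M cardsE (card_uniqP ums) !size_map.
Qed.

End EdgeLists.

(** * Encoded instances and the running time on them *)

Section Instance.
Variables (R : realType) (n w : nat) (E : {set {set 'I_n}}).
Variables (x : {set 'I_n} -> R) (eps : R) (es : seq ('I_n * 'I_n)).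
Hypothesis simpleE : simple_graph E.
Hypothesis bipE : bipartite E.
Hypothesis fmE : fractional_matching E x.
Hypothesis epsE : 0 < eps < 1.
Hypothesis esE : edge_list (supp E x) es.
Hypothesis w_bits : (8 * (trunc_log 2 n).+1 <= w)%N.

Notation m := (size es).
Notation Lambda := (ln (eps^-1 * (xmin E x)^-1)).

Definition weight j : R := if onth es j is Some p then x (edge p) else 0.

Lemma weightE p0 j : (j < m)%N -> weight j = x (edge (nth p0 es j)).
Proof. by move=> jm; rewrite /weight (onth_lt p0). Qed.

Lemma card_supp : #|supp E x| = m.
Proof.
have [u mem] := esE; rewrite -(eq_card mem) (card_uniqP u).
by rewrite size_map.
Qed.

Lemma norm1_supp : norm1 E x = \sum_(e in supp E x) x e.
Proof.
have [x0 _] := fmE; rewrite /norm1 big_mkcond [RHS]big_mkcond.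
apply: eq_bigr => e _; rewrite inE; case eE: (e \in E) => //=.
by have := x0 _ eE; rewrite le_eqVlt => /orP [/eqP <-|->] //; rewrite ltxx.
Qed.

Lemma weight_in j : (j < m)%N -> 0 < weight j <= 1.
Proof.
move=> jm; have [p0 _] : exists p0 : 'I_n * 'I_n, True.
  by case: (es) jm => // p0 s _; exists p0.
by rewrite (weightE p0) //; exact: (weight_bounds p0 fmE esE).
Qed.

Lemma xmin_weight j : (j < m)%N -> xmin E x <= weight j.
Proof.
move=> jm; have [p0 _] : exists p0 : 'I_n * 'I_n, True.
  by case: (es) jm => // p0 s _; exists p0.
by rewrite (weightE p0) //; apply/xmin_le/nedge_supp.
Qed.

Lemma xmin_in : 0 < xmin E x <= 1.
Proof.
case Ees: es => [|p0 s]; last exact: (xmin_bounds p0 fmE esE).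
rewrite /xmin big_pred0 ?ltr01 ?lexx // => e.
by have [_ <-] := esE; rewrite Ees.
Qed.

Lemma Lambda_split : Lambda = ln eps^-1 + ln (xmin E x)^-1 /\
  1 - eps <= ln eps^-1 /\ 1 - xmin E x <= ln (xmin E x)^-1.
Proof.
have /andP [e0 e1] := epsE; have /andP [x0 x1] := xmin_in.
rewrite lnM ?posrE ?invr_gt0 // !lnV ?posrE //.
by have := ln_le_sub1 e0; have := ln_le_sub1 x0; split=> //; split; lra.
Qed.

(** Addresses reach about 8 times the number of edges, which is at most [n * n]; the eighth power of
    a number above [n] leaves ample room. *)
Lemma word_bound : (8 * (n * n) + 8 <= 2 ^ w)%N /\ (8 <= w)%N /\ (8 * n + 8 <= 2 ^ w)%N.
Proof.
have wb := w_bits; set l := trunc_log 2 n in wb.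
have nB : (n < 2 ^ l.+1)%N := trunc_log_ltn n (isT : 1 < 2)%N.
set B := (2 ^ l.+1)%N in nB.
have B2 : (2 <= B)%N by rewrite /B expnS (leq_pmulr 2) // expn_gt0.
have BW : (B ^ 8 <= 2 ^ w)%N by rewrite /B -expnM leq_exp2l // mulnC.
have B8 : (B ^ 8 = (B * B) * B ^ 6)%N by rewrite !expnS expn0; lia.
have B6 : (64 <= B ^ 6)%N by apply: (@leq_trans (2 ^ 6)) => //; rewrite leq_exp2r.
have nn : (n * n + 1 <= B * B)%N by nia.
have h : (8 * (B * B) <= 2 ^ w)%N.
  apply: leq_trans BW; rewrite B8 mulnC leq_mul2l; apply/orP; right; lia.
split; first lia.
split; first lia.
have : (n + 1 <= B * B)%N by nia.
lia.
Qed.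

Lemma instance_input :
  graph_input w (encode w x eps es) m (endpoint es).
Proof.
have [h1 [h2 h3]] := word_bound.
split.
- by apply: leq_trans (_ : 2 ^ 8 <= _)%N => //; rewrite leq_exp2l.
- by have := size_edges esE; lia.
- move=> j s jm s2; rewrite /endpoint; case: (onth es j) => [p|]; last lia.
  by case: ifP => _; have := ltn_ord p.1; have := ltn_ord p.2; lia.
- move=> j s jm s2; rewrite addn2 /endpoint /=.
  by case: (onth es j) => [[u v]|]; case: s s2 => [|[|]].
Qed.

Lemma encode_weight j k : (j < m)%N ->
  encode w x eps es (j + 2) (k + 2) = (scaled (weight j) (w * k) %% 2 ^ w)%N.
Proof.
move=> jm; rewrite !addn2 /weight /=.
by have := onthTE es j; rewrite jm; case: (onth es j) => [[u v]|].
Qed.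

Hypothesis w_precise : 8%:R * Lambda <= 2%:R ^+ w.

Lemma run_rounding : exists t r mu K b (js := selected (fun j => scaled (weight j)) b K),
  [/\ halts_within w (encode w x eps es) t rounding (State r mu),
    (K <= m)%N, r 0%N = size js, listed (endpoint es) js mu &
    [/\ (1 - eps) * m%:R <= K%:R, forall j, (j < K)%N -> 1 / 2%:R < weight j,
      forall j, (j < K)%N -> b j = 1%N & t%:R <= 90%:R * 100%:R * (1 + m%:R * Lambda)] \/
    [/\ K = m,
      forall v, (\sum_(j < m) incidence (endpoint es) v j * (scaled (weight j) 0 + b j) <= 1)%N,
      (1 - eps) * \sum_(j < m) weight j <= (\sum_(j < m) (scaled (weight j) 0 + b j))%N%:R &
      t%:R <= 90%:R * 100%:R * (1 + m%:R * Lambda)]].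
Proof.
have [h1 [w8 h3]] := word_bound.
have /andP [e0 e1] := epsE; have /andP [x0 x1] := xmin_in.
have [EL [Le Lx]] := Lambda_split.
have G := instance_input.
have e01 : 0 < eps <= 1 by rewrite e0 ltW.
have [le [lead_e le1 le2]] := leading_scaled e01.
have leads j : exists l, (j < m)%N -> [/\ leading (scaled (weight j)) l,
    1 <= weight j * 2%:R ^+ l & l%:R <= 1 + 2%:R * ln (weight j)^-1].
  case: (ltnP j m) => jm; last by exists 0%N.
  by have [l lP] := leading_scaled (weight_in jm); exists l.
have [ld ldP] := boolp.choice leads.
pose lb := \max_(j < m) ld j.
have ldb j : (j < m)%N -> (ld j <= lb)%N.
  by move=> jm; exact: (leq_bigmax (Ordinal jm)).
have lbE : lb%:R <= 1 + 2%:R * ln (xmin E x)^-1.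
  rewrite /lb; apply: (big_ind (fun k : nat => (k%:R : R) <= 1 + 2%:R * ln (xmin E x)^-1)).
  - lra.
  - by move=> a b ha hb; rewrite /maxn; case: ifP.
  - move=> j _; have [_ _ h] := ldP _ (ltn_ord j); apply: le_trans h _.
    have /andP [wj _] := weight_in (ltn_ord j).
    have := xmin_weight (ltn_ord j).
    by rewrite -(ler_ln (_ : _ \is Num.pos) (_ : _ \is Num.pos)) ?posrE // !lnV ?posrE //; lra.
have W256 : (256 <= 2 ^ w)%N := word_large G.
have lw : (le + lb + 5 < 2 ^ w)%N.
  (* The second word-size hypothesis enters here: level numbers and digit positions fit into a
     word. *)
  have : ((4 * (le + lb))%N%:R : R) <= (8 + 2 ^ w)%N%:R.
    have wp' := w_precise; rewrite EL in wp'.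
    by rewrite natrM !natrD natrX; lra.
  by rewrite ler_nat => h; clear -h W256; lia.
have X0 j : (j < m)%N -> (scaled (weight j) 0 <= 1)%N.
  by move=> /weight_in /andP [_ h]; rewrite truncn_le_nat expr0; lra.
have Xb j : (j < m)%N -> binary (scaled (weight j)).
  by move=> /weight_in /andP [/ltW h _]; exact: binary_scaled.
(* The edge-list lemmas need a default pair [p0], which may not exist when the list is empty. *)
have m0P : m = 0%N \/ exists p0 : 'I_n * 'I_n, True.
  by case: (es) => [|p0 s]; [left | right; exists p0].
have [side sideP] : exists side : nat -> bool,
    forall j, (j < m)%N -> side (endpoint es j 1) = ~~ side (endpoint es j 0).
  case: m0P => [->|[p0 _]]; first by exists xpredT.
  exact: (side_exists p0 simpleE bipE esE).
have loads i v : (\sum_(j < m) incidence (endpoint es) v j * scaled (weight j) i <= 2 ^ i)%N.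
  case: m0P => [-> |[p0 _]]; first by rewrite big_ord0.
  have := scaled_load p0 simpleE fmE esE i v; congr leq.
  by apply: eq_bigr => j _; rewrite (weightE p0).
have inp_e k : encode w x eps es 1 k = (scaled eps (w * k) %% 2 ^ w)%N by [].
have ld_lead j : (j < m)%N -> leading (scaled (weight j)) (ld j).
  by move=> jm; have [] := ldP j jm.
have zero (a : nat) : (fun _ : nat => 0%N) a = 0%N by [].
have inp_m : encode w x eps es 0 1 = m by [].
have := @wp_rounding m (endpoint es) (fun j => scaled (weight j)) w (encode w x eps es)
  G w8 encode_weight X0 side sideP Xb (scaled eps) le ld lb (fun _ : nat => 0%N) inp_m zero
  (binary_scaled (ltW e0)) lead_e inp_e ld_lead ldb lw loads.
case=> t [r [mu [run [K [b [Km r0 Ls out]]]]]].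
have [Klo Khi] := shortcut_size_bounds epsE (edges_small G).
exists t, r, mu, K, b; split=> //; first by have := run [::]; rewrite cats0.
have m0 : 0 <= (m%:R : R) by [].
have mL : m%:R * (1 - eps) <= m%:R * Lambda by rewrite ler_wpM2l //; lra.
set Ks := shortcut_size m w (digit w eps 1) in Klo Khi.
case: out => [[EK hv b1 tb]|[EK [j0 j0m nh] load [L [Lge S]] tb]]; [left|right].
- change (K = Ks) in EK; rewrite -EK in Klo Khi.
  change (forall j, (j < Ks)%N -> heavy (fun j => scaled (weight j)) w j) in hv.
  change (forall j, (j < Ks)%N -> b j = 1%N) in b1.
  change (is_true (t <= 40 * (Ks + 1))%N) in tb.
  rewrite -EK in hv b1 tb; clear EK.
  split=> //.
  + move=> j jK; have jm := leq_trans jK Km.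
    apply: (@heavy_gt_half R w (weight j) (fun j => scaled (weight j)) j _ _ _ (hv _ jK)) => //.
      by apply: leq_trans w8.
    by have /andP [/ltW -> ->] := weight_in jm.
  + have tb' : (t%:R : R) <= 40%:R * (K%:R + 1).
      by rewrite natr1 -natrM ler_nat; move: tb; rewrite addn1.
    have mL0 : 0 <= m%:R * (1 - eps) by rewrite mulr_ge0 //; lra.
    by lra.
- split=> //.
  + have p0 : 0 < (2%:R : R) ^+ L by rewrite exprn_gt0.
    rewrite -(ler_pM2l p0); set N := (\sum_(j < m) _)%N.
    have S' : ((\sum_(j < m) scaled (weight j) L)%N%:R : R) <= 2%:R ^+ L * N%:R.
      rewrite -natrX -natrM ler_nat; exact: S.
    apply: le_trans S'; rewrite natr_sum !mulr_sumr; apply: ler_sum => j _.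
    have [_ wj _] := ldP _ (ltn_ord j).
    have /andP [wj0 wj1] := weight_in (ltn_ord j).
    have /andP [_ up] := scaledP L (ltW wj0).
    have grow : (2%:R : R) ^+ (le + ld j) <= 2%:R ^+ L.
      by rewrite ler_weXn2l ?Lge // ler1n.
    (* The truncation error in units of [2^-L] is below 1, hence below [eps x_e 2^L]; this is the
       loss of a factor 1 - eps. *)
    have big : 1 <= eps * weight j * 2%:R ^+ L.
      apply: le_trans (_ : eps * weight j * 2%:R ^+ (le + ld j) <= _); last first.
        by rewrite ler_wpM2l // mulr_ge0 // ltW.
      rewrite exprD mulrACA; rewrite -[leLHS]mulr1; apply: ler_pM => //.
    rewrite -natr1 in up.
    by set z := (scaled _ _)%:R in up *; lra.
  + have wj : xmin E x <= 3%:R / 4%:R.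
      apply: le_trans (xmin_weight j0m) _.
      apply: (@not_heavy_le R w (weight j0) (fun j => scaled (weight j)) j0 w8 _ _ nh) => //.
      by have /andP [/ltW -> ->] := weight_in j0m.
    (* From [1 - xmin <= ln (1/xmin)]. Now 600 m (3 + 2 Lambda) is at most 8400 m Lambda, because m
       <= 4 m Lambda; the constant 9000 covers this. *)
    have L4 : 1 / 4%:R <= Lambda by lra.
    have LL : (le + lb)%N%:R <= 2%:R + 2%:R * Lambda by rewrite natrD EL; lra.
    have m1 : 1 <= (m%:R : R) by rewrite ler1n; apply: leq_ltn_trans j0m.
    have tb' : (t%:R : R) <= 300%:R * (m%:R + 1) * ((le + lb)%N%:R + 1).
      by rewrite !natr1 -!natrM ler_nat; move: tb; rewrite !addn1.
    apply: le_trans tb' _; move: ((le + lb)%N%:R) LL (ler0n R (le + lb)) => a LL a0.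
    have s2 : 300%:R * (m%:R + 1) <= 600%:R * (m%:R : R) by lra.
    have s4 : m%:R * a <= m%:R * (2%:R + 2%:R * Lambda) by rewrite ler_wpM2l.
    have s5 : m%:R * (1 / 4%:R) <= m%:R * Lambda by rewrite ler_wpM2l.
    have s6 : 0 <= a + 1 by lra.
    have s7 : 300%:R * (m%:R + 1) * (a + 1) <= 600%:R * m%:R * (a + 1).
      by rewrite ler_wpM2r.
    by lra.
Qed.

End Instance.

(** The two conditions on [w] let a word address the graph and count the bits of precision. The
    additive 1 in the time absorbs the set-up, since the product can be arbitrarily close to 0. *)
Theorem theorem3p1 :
  exists (P : prog) (c C : nat),
  forall (R : realType) (n w : nat) (E : {set {set 'I_n}})
         (x : {set 'I_n} -> R) (eps : R) (es : seq ('I_n * 'I_n)),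
    simple_graph E -> bipartite E -> fractional_matching E x ->
    0 < eps < 1 ->
    edge_list (supp E x) es ->
    (c * (trunc_log 2 n).+1 <= w)%N ->
    c%:R * ln (eps^-1 * (xmin E x)^-1) <= 2%:R ^+ w ->
    exists (t : nat) (s : state) (M : {set {set 'I_n}}),
      [/\ halts_within w (encode w x eps es) t P s,
          outputs s M,
          integral_matching E M /\ M \subset supp E x,
          (1 - eps) * norm1 E x <= #|M|%:R &
          t%:R <= C%:R * (1 + #|supp E x|%:R * ln (eps^-1 * (xmin E x)^-1))].
Proof.
exists rounding, 8%N, (90 * 100)%N => R n w E x eps es sE bE fE eE esE wb wp.
have [t [r [mu [K [b [run Km r0 Ls out]]]]]] := run_rounding sE bE fE eE esE wb wp.
exists t, (State r mu).
rewrite (card_supp esE) natrM norm1_supp //.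
have /andP [e0 e1] := eE.
have tb : t%:R <= 90%:R * 100%:R * (1 + (size es)%:R * ln (eps^-1 * (xmin E x)^-1)).
  by case: out => [[]|[]].
(* An empty support has no pair to serve as default and is answered by the empty matching. *)
case Ees: es => [|p0 s].
  have E0 : supp E x = set0 by apply/setP => e; rewrite in_set0; have [_ <-] := esE; rewrite Ees.
  exists set0; rewrite E0 big_set0 mulr0 cards0 -Ees; split=> //.
  - exists [::]; split=> [|//|j u v]; last by rewrite onth0n.
      by split=> // e; rewrite inE.
    by move: Km r0; rewrite Ees leqn0 => /eqP ->.
  - split; first by split; [exact: sub0set | apply/trivIsetP => A B; rewrite inE].
    exact: sub0set.
rewrite -Ees in esE *.
have wE j : (j < size es)%N -> weight x es j = x (edge (nth p0 es j)) by exact: weightE.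
have wpos j : (j < size es)%N -> 0 < weight x es j <= 1 by exact: (weight_in fE esE).
have wsum : \sum_(e in supp E x) x e = \sum_(j < size es) weight x es j.
  by rewrite (sum_edges p0 esE); apply: eq_bigr => j _; rewrite wE.
set js := selected _ b K in r0 Ls.
have ujs : uniq js by rewrite filter_uniq // iota_uniq.
have jsK j : j \in js -> (j < K)%N by rewrite mem_filter mem_iota => /andP [].
have jsm j : j \in js -> (j < size es)%N by move=> /jsK jK; exact: leq_trans jK Km.
case: out => [[Klo half b1 _]|[EK load big _]].
- have loads (v : 'I_n) :
      \sum_(j < size es) (incidence (endpoint es) v j)%:R * weight x es j <= 1.
    apply: le_trans (weighted_load p0 sE fE esE v).
    by apply: ler_sum => j _; rewrite wE.
  have w0 j : (j < size es)%N -> 0 <= weight x es j.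
    by move=> /wpos /andP [/ltW].
  have [M [oM iM cM]] :=
    selected_matching p0 sE esE ujs jsm w0 (fun j jjs => half j (jsK j jjs)) loads r0 Ls.
  exists M; split=> //; rewrite cM wsum.
  have -> : size js = K.
    (* Carry 1 lets every inspected edge pass the filter. *)
    rewrite /js /selected (all_filterP _) ?size_iota //.
    by apply/allP => j; rewrite mem_iota => /b1 ->; rewrite addn1.
  apply: le_trans Klo; rewrite ler_wpM2l //; first lra.
  apply: le_trans (_ : \sum_(j < size es) 1 <= _).
    by apply: ler_sum => j _; have /andP [] := wpos j (ltn_ord j).
  by rewrite sumr_const card_ord.
- pose g j := scaled (weight x es j) 0 + b j.
  have g0 j : (j < size es)%N -> 0 <= (g j)%:R :> R by [].
  have gh j : j \in js -> 1 / 2%:R < (g j)%:R :> R.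
    rewrite mem_filter => /andP [gj _].
    by have : (1 : R) <= (g j)%:R; [rewrite ler1n lt0n | lra].
  have loads (v : 'I_n) :
      \sum_(j < size es) (incidence (endpoint es) v j)%:R * (g j)%:R <= 1 :> R.
    have := load v; rewrite -(ler_nat R) natr_sum.
    by congr (_ <= _); apply: eq_bigr => j _; rewrite natrM.
  have [M [oM iM cM]] := selected_matching p0 sE esE ujs jsm g0 gh loads r0 Ls.
  exists M; split=> //; rewrite cM wsum; apply: le_trans big _; rewrite ler_nat.
  have -> : size js = (\sum_(j < size es) (g j != 0%N))%N.
    rewrite /js /selected size_filter EK -(big_mkord xpredT (fun j => (g j != 0%N) : nat)).
    by rewrite -sum1_count big_mkcond /index_iota subn0.
  (* The load at an endpoint bounds each final value by 1, so the sum of the values is the number of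
     selected edges. *)
  apply: leq_sum => j _; have ld := load (endpoint es j 0).
  have : (g j <= 1)%N.
    apply: leq_trans ld; rewrite (bigD1 j) //= /incidence eqxx mulnDl mul1n -addnA.
    exact: leq_addr.
  by move=> g1; have : (g j <= (g j != 0))%N by case: (g j) g1 => [|[]].
Qed.
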